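(* Let $\mathcal{A}_2=[2:\omega]$ be the countable rank-$2$ tree in which, among the level-one nodes, every finite degree occurs infinitely often and infinite degree occurs infinitely often. Then: \begin{enumerate} \item the orbit $O_\omega$ of level-one nodes of infinite degree is $\Pi^{\mathrm{in}}_{2}$-definable but not $\Sigma^{\mathrm{in}}_{2}$-definable; \item $\mathcal{A}_2$ has a $\Pi^{\mathrm{in}}_{4}$ Scott sentence but no $\Pi^{\mathrm{in}}_{3}$, $\Sigma^{\mathrm{in}}_{3}$, or $\mathrm{d}\text{-}\Sigma^{\mathrm{in}}_{3}$ Scott sentence; hence $\operatorname{SSC}(\mathcal{A}_2)=\Pi^{\mathrm{in}}_{4}$ and $\operatorname{SR}(\mathcal{A}_2)=\operatorname{pSR}(\mathcal{A}_2)=3$; \item the canonical computable copy of $\mathcal{A}_2$ has a c.e. Scott family of $\Sigma^{\mathrm{c}}_{3}$ formulas and therefore $\mathcal{A}_2$ has a computable $\Pi^{\mathrm{c}}_{4}$ Scott sentence; the computable Scott sentence complexity of $\mathcal{A}_2$ is also exactly $\Pi^{\mathrm{c}}_{4}$. \end{enumerate}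
   Context: Trees. A tree is a structure $(T,\prec)$ in the language $\{\prec\}$ where $\prec$ is a strict partial order, the predecessors of each element form a finite linearly ordered set, and there is a $\prec$-least element, the root. The level of $x$ is its number of predecessors. Rank: terminal nodes have rank $0$, $\mathrm{rk}(x)=\sup\{\mathrm{rk}(y)+1: y$ an immediate successor of $x\}$, and the rank of $T$ is that of its root. The degree of a level-one node of a tree of rank $\leq2$ is its number of children (immediate successors), in $\omega\cup\{\omega\}$. Canonical computable copy of $\mathcal{A}_2$: universe $\omega$, root $0$; level-one nodes $a_{k,j}$ ($k,j\in\omega$) and $b_j$ ($j\in\omega$) under a fixed computable coding; the children of $a_{k,j}$ are $a_{k,j,1},\dots,a_{k,j,k}$, and the children of $b_j$ are $b_{j,i}$ ($i\in\omega$). Infinitary formulas: $\Sigma^{\mathrm{in}}_0=\Pi^{\mathrm{in}}_0$ are the finitary quantifier-free formulas; for $\alpha\geq1$, a $\Sigma^{\mathrm{in}}_\alpha$ formula is a countable disjunction of formulas $\exists\bar y\,\psi$ with $\psi\in\Pi^{\mathrm{in}}_\beta$, $\beta<\alpha$, and dually $\Pi^{\mathrm{in}}_\alpha$. A $\mathrm{d}\text{-}\Sigma^{\mathrm{in}}_\alpha$ formula is a conjunction of a $\Sigma^{\mathrm{in}}_\alpha$ and a $\Pi^{\mathrm{in}}_\alpha$ formula. $\Sigma^{\mathrm{c}}_\alpha,\Pi^{\mathrm{c}}_\alpha$ are the corresponding classes of computable infinitary formulas (disjunctions and conjunctions over c.e. sets, in the sense of Ash–Knight). A Scott sentence of a countable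 structure is an $L_{\omega_1\omega}$ sentence whose countable models are exactly its isomorphic copies. $\operatorname{SSC}(\mathcal{A})$ is the least complexity among $\Sigma^{\mathrm{in}}_\alpha,\Pi^{\mathrm{in}}_\alpha,\mathrm{d}\text{-}\Sigma^{\mathrm{in}}_\alpha$ of a Scott sentence of $\mathcal{A}$, in the ordering $\Sigma^{\mathrm{in}}_\alpha,\Pi^{\mathrm{in}}_\alpha<\mathrm{d}\text{-}\Sigma^{\mathrm{in}}_\alpha<\Sigma^{\mathrm{in}}_{\alpha+1},\Pi^{\mathrm{in}}_{\alpha+1}$; the computable Scott sentence complexity is the analogous least complexity among computable infinitary Scott sentences. $\operatorname{SR}(\mathcal{A})$ is the least $\alpha$ such that every automorphism orbit of every finite tuple of $\mathcal{A}$ is definable by a parameter-free $\Sigma^{\mathrm{in}}_\alpha$ formula; $\operatorname{pSR}(\mathcal{A})$ is the least value of $\operatorname{SR}((\mathcal{A},\bar p))$ over finite tuples $\bar p$ of named parameters. A (parameterless) Scott family is a set of formulas without parameters, each defining an automorphism orbit of a finite tuple, such that every orbit of a finite tuple is defined by some formula of the set. Definability is without parameters. *)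

(* Defs.v *)
From mathcomp Require Import all_boot.
From Stdlib Require Cantor.

Set Implicit Arguments.
Unset Strict Implicit.
Unset Printing Implicit Defensive.

(** * Countable ordinals *)

(* Brouwer notations: [blim f] is the supremum of the [f n] (no monotonicity is
   required), so every countable ordinal is denoted, by many terms.  Ordinals
   are compared through [ole] and [olt] only, never by Leibniz equality. *)
Inductive bord : Type :=
| bzero
| bsucc of bord
| blim of (nat -> bord).

Fixpoint ole (a : bord) : bord -> Prop :=
  match a with
  | bzero => fun _ => True
  | bsucc a' =>
      fix olt_a' (b : bord) : Prop :=
        match b with
        | bzero => False
        | bsucc b' => ole a' b'
        | blim f => exists n, olt_a' (f n)
        end
  | blim f => fun b => forall n, ole (f n) b
  end.

Definition olt (a b : bord) : Prop := ole (bsucc a) b.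
Definition oeq (a b : bord) : Prop := ole a b /\ ole b a.

Definition bfin (n : nat) : bord := iter n bsucc bzero.

(** * Structures *)

(* Structures for the language with one binary relation and [k] constant
   symbols; [k = 0] is the language of trees, and the constants are used to name
   parameters. *)
Record structure (k : nat) : Type := Structure {
  carrier :> Type;
  prec : carrier -> carrier -> Prop;
  cst : k.-tuple carrier;
  carrier_inhabited : inhabited carrier
}.

Arguments prec {k s} _ _.

Definition name_params (A : structure 0) (k : nat) (p : k.-tuple A) :
    structure k :=
  Structure (@prec 0 A) p (carrier_inhabited A).

Definition is_iso (k : nat) (A B : structure k) (f : A -> B) : Prop :=
  [/\ bijective f,
      forall x y : A, prec x y <-> prec (f x) (f y)
    & map_tuple f (cst A) = cst B].

Definition iso (k : nat) (A B : structure k) : Prop :=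
  exists f : A -> B, is_iso f.

Definition aut_orbit (k : nat) (A : structure k) (n : nat) (t s : n.-tuple A) :
    Prop :=
  exists f : A -> A, is_iso f /\ s = map_tuple f t.

Definition countable (T : Type) : Prop := exists f : T -> nat, injective f.

(* [None] stands for the cardinality omega. *)
Definition has_card (T : Type) (P : T -> Prop) (c : option nat) : Prop :=
  match c with
  | Some n =>
      exists f : 'I_n -> T, injective f /\ forall y, P y <-> exists i, f i = y
  | None =>
      exists f : nat -> T, injective f /\ forall y, P y <-> exists i, f i = y
  end.

(** * Trees *)

Definition is_root (A : structure 0) (r : A) : Prop :=
  forall x : A, x <> r -> prec r x.

Definition level (A : structure 0) (x : A) (n : nat) : Prop :=
  has_card (fun y : A => prec y x) (Some n).

Definition is_tree (A : structure 0) : Prop :=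
  [/\ forall x : A, ~ prec x x,
      forall x y z : A, prec x y -> prec y z -> prec x z,
      forall x : A, exists n, level x n,
      forall x y z : A, prec y x -> prec z x -> [\/ prec y z, y = z | prec z y]
    & exists r : A, is_root r].

Definition child (A : structure 0) (x y : A) : Prop :=
  prec x y /\ ~ exists z : A, prec x z /\ prec z y.

(* The supremum of the [rk y + 1] is the least strict upper bound of the
   [rk y]; it is 0 when [x] is terminal. *)
Inductive has_rank (A : structure 0) (x : A) (a : bord) : Prop :=
| HasRank (r : A -> bord) of
    (forall y, child x y -> has_rank y (r y))
  & (forall y, child x y -> olt (r y) a)
  & (forall b, (forall y, child x y -> olt (r y) b) -> ole a b).

Definition tree_rank (A : structure 0) (a : bord) : Prop :=
  exists r : A, is_root r /\ has_rank r a.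

Definition degree (A : structure 0) (x : A) (c : option nat) : Prop :=
  has_card (child x) c.

Definition is_A2 (A : structure 0) : Prop :=
  [/\ countable A, is_tree A, tree_rank A (bfin 2)
    & forall c : option nat,
        has_card (fun x : A => level x 1 /\ degree x c) None].

Definition O_omega (A : structure 0) (t : 1.-tuple A) : Prop :=
  level (thead t) 1 /\ degree (thead t) None.

(** * Infinitary formulas *)

Inductive term (k n : nat) : Type :=
| Var of 'I_n
| Cst of 'I_k.

(* Finitary quantifier-free formulas with free variables among the first [n]. *)
Inductive qf (k n : nat) : Type :=
| QTrue
| QLt of term k n & term k n
| QEq of term k n & term k n
| QNot of qf k n
| QAnd of qf k n & qf k n
| QOr of qf k n & qf k n.

(* Formulas of L_{omega_1 omega} with free variables among the first [n].
   [Or J F] is the disjunction of the [F i] for [i] in [J], a possibly finite or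
   empty set; the other values of [F] are irrelevant.  [Ex m phi] quantifies the
   [m] last variables of [phi] as a block. *)
Inductive form (k n : nat) : Type :=
| QF of qf k n
| Not of form k n
| Or of (nat -> Prop) & (nat -> form k n)
| And of (nat -> Prop) & (nat -> form k n)
| Ex m of form k (n + m)
| All m of form k (n + m).

Arguments Or {k n} _ _.
Arguments And {k n} _ _.
Arguments Ex {k n m} _.
Arguments All {k n m} _.

Definition And2 (k n : nat) (phi psi : form k n) : form k n :=
  And (fun i => i < 2) (fun i => if i is 0 then phi else psi).

Definition tval (k : nat) (A : structure k) (n : nat) (t : n.-tuple A)
    (u : term k n) : A :=
  match u with
  | Var i => tnth t i
  | Cst i => tnth (cst A) i
  end.

Fixpoint qsat (k : nat) (A : structure k) (n : nat) (t : n.-tuple A)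
    (q : qf k n) : Prop :=
  match q with
  | QTrue => True
  | QLt u v => prec (tval t u) (tval t v)
  | QEq u v => tval t u = tval t v
  | QNot q1 => ~ qsat t q1
  | QAnd q1 q2 => qsat t q1 /\ qsat t q2
  | QOr q1 q2 => qsat t q1 \/ qsat t q2
  end.

Fixpoint sat (k : nat) (A : structure k) (n : nat) (phi : form k n) :
    n.-tuple A -> Prop :=
  match phi with
  | QF q => fun t => qsat t q
  | Not phi1 => fun t => ~ sat phi1 t
  | Or J F => fun t => exists i, J i /\ sat (F i) t
  | And J F => fun t => forall i, J i -> sat (F i) t
  | Ex m psi => fun t => exists s : m.-tuple A, sat psi (cat_tuple t s)
  | All m psi => fun t => forall s : m.-tuple A, sat psi (cat_tuple t s)
  end.

Fixpoint is_Sigma (k n : nat) (a : bord) (phi : form k n) {struct phi} : Prop :=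
  match phi with
  | QF _ => ole a bzero
  | Or J F =>
      olt bzero a /\
      forall i, J i ->
        match F i with
        | Ex _ psi => exists b, olt b a /\ is_Pi b psi
        | _ => False
        end
  | _ => False
  end
with is_Pi (k n : nat) (a : bord) (phi : form k n) {struct phi} : Prop :=
  match phi with
  | QF _ => ole a bzero
  | And J F =>
      olt bzero a /\
      forall i, J i ->
        match F i with
        | All _ psi => exists b, olt b a /\ is_Sigma b psi
        | _ => False
        end
  | _ => False
  end.

Definition fclass (k : nat) : Type := forall n : nat, form k n -> Prop.

Definition conj_class (k : nat) (C D : fclass k) : fclass k :=
  fun n phi => exists psi chi, [/\ C n psi, D n chi & phi = And2 psi chi].

(** * Complexities *)

Inductive complexity : Type :=
| CSigma of bord
| CPi of bord
| CdSigma of bord.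

Definition clevel (G : complexity) : bord :=
  match G with CSigma a | CPi a | CdSigma a => a end.

Definition ckind_le (G H : complexity) : Prop :=
  match G, H with
  | CSigma _, CSigma _ | CPi _, CPi _ | _, CdSigma _ => True
  | _, _ => False
  end.

Definition complexity_le (G H : complexity) : Prop :=
  olt (clevel G) (clevel H) \/ (oeq (clevel G) (clevel H) /\ ckind_le G H).

Definition class_in (k : nat) (G : complexity) : fclass k :=
  match G with
  | CSigma a => fun n => @is_Sigma k n a
  | CPi a => fun n => @is_Pi k n a
  | CdSigma a =>
      conj_class (fun n => @is_Sigma k n a) (fun n => @is_Pi k n a)
  end.

Definition defines (k : nat) (A : structure k) (n : nat) (phi : form k n)
    (P : n.-tuple A -> Prop) : Prop :=
  forall t : n.-tuple A, sat phi t <-> P t.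

Definition definable (k : nat) (C : fclass k) (A : structure k) (n : nat)
    (P : n.-tuple A -> Prop) : Prop :=
  exists phi : form k n, C n phi /\ defines phi P.

Definition scott_sentence (A : structure 0) (phi : form 0 0) : Prop :=
  forall B : structure 0,
    countable B -> (sat phi [tuple of [::] : seq B] <-> iso A B).

Definition has_scott_sentence (C : fclass 0) (A : structure 0) : Prop :=
  exists phi : form 0 0, C 0 phi /\ scott_sentence A phi.

(* [is_complexity cl A G]: [G] is the least Scott sentence complexity of [A]
   when formulas of complexity [G] are those in [cl G]. *)
Definition is_complexity (cl : complexity -> fclass 0) (A : structure 0)
    (G : complexity) : Prop :=
  has_scott_sentence (cl G) A /\
  forall H, has_scott_sentence (cl H) A -> complexity_le G H.

Definition is_SSC (A : structure 0) (G : complexity) : Prop :=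
  is_complexity (@class_in 0) A G.

Definition orbits_definable (k : nat) (A : structure k) (a : bord) : Prop :=
  forall (n : nat) (t : n.-tuple A),
    definable (class_in (CSigma a)) (aut_orbit t).

Definition is_SR (k : nat) (A : structure k) (a : bord) : Prop :=
  orbits_definable A a /\ forall b, orbits_definable A b -> ole a b.

Definition is_pSR (A : structure 0) (a : bord) : Prop :=
  (exists k (p : k.-tuple A), is_SR (name_params p) a) /\
  (forall k (p : k.-tuple A) b, is_SR (name_params p) b -> ole a b).

Definition scott_family (k : nat) (A : structure k) (S : fclass k) : Prop :=
  (forall n (phi : form k n),
     S n phi -> exists t : n.-tuple A, defines phi (aut_orbit t)) /\
  (forall n (t : n.-tuple A), definable S (aut_orbit t)).

(** * Computability *)

Definition cpair (x y : nat) : nat := Cantor.to_nat (x, y).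
Definition cleft (x : nat) : nat := (Cantor.of_nat x).1.
Definition cright (x : nat) : nat := (Cantor.of_nat x).2.

Inductive code : Type :=
| KZero
| KSucc
| KLeft
| KRight
| KPair of code & code
| KComp of code & code
| KPrec of code & code
| KMu of code.

(* The unary partial recursive functions, inputs with several arguments being
   packed with [cpair]:
   [KPrec f g] is h with h<a,0> = f a and h<a,i+1> = g<a,<i,h<a,i>>>;
   [KMu f] maps x to the least y with f<x,y> = 0. *)
Fixpoint eval (c : code) (x y : nat) {struct c} : Prop :=
  match c with
  | KZero => y = 0
  | KSucc => y = x.+1
  | KLeft => y = cleft x
  | KRight => y = cright x
  | KPair f g => exists u v, [/\ eval f x u, eval g x v & y = cpair u v]
  | KComp f g => exists z, eval g x z /\ eval f z y
  | KPrec f g =>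
      (fix rec (i z : nat) {struct i} : Prop :=
         match i with
         | 0 => eval f (cleft x) z
         | j.+1 =>
             exists w, rec j w /\ eval g (cpair (cleft x) (cpair j w)) z
         end) (cright x) y
  | KMu f =>
      eval f (cpair x y) 0 /\
      forall z, z < y -> exists v, eval f (cpair x z) v.+1
  end.

Fixpoint goedel (c : code) : nat :=
  match c with
  | KZero => cpair 0 0
  | KSucc => cpair 1 0
  | KLeft => cpair 2 0
  | KRight => cpair 3 0
  | KPair f g => cpair 4 (cpair (goedel f) (goedel g))
  | KComp f g => cpair 5 (cpair (goedel f) (goedel g))
  | KPrec f g => cpair 6 (cpair (goedel f) (goedel g))
  | KMu f => cpair 7 (goedel f)
  end.

(* [Phi e x y]: the [e]-th partial recursive function maps [x] to [y]; it is
   nowhere defined if [e] codes no program. *)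
Definition Phi (e x y : nat) : Prop := exists c, goedel c = e /\ eval c x y.

Definition W (e x : nat) : Prop := exists y, Phi e x y.

Definition ce (S : nat -> Prop) : Prop := exists e, forall x, S x <-> W e x.

(* Kleene's O.  On notations below a member of O, [klt] is <_O. *)
Inductive klt : nat -> nat -> Prop :=
| klt_succ a of 0 < a : klt a (2 ^ a)
| klt_lim e i a of Phi e i a : klt a (3 * 5 ^ e)
| klt_trans a b c of klt a b & klt b c : klt a c.

Inductive O_notation : nat -> bord -> Prop :=
| notation_zero : O_notation 1 bzero
| notation_succ a al of O_notation a al : O_notation (2 ^ a) (bsucc al)
| notation_lim e (f : nat -> nat) (al : nat -> bord) of
    (forall i, Phi e i (f i))
  & (forall i, klt (f i) (f i.+1))
  & (forall i, O_notation (f i) (al i)) :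
    O_notation (3 * 5 ^ e) (blim al).

(** * Computable infinitary formulas *)

Definition tcode (k n : nat) (u : term k n) : nat :=
  match u with
  | Var i => cpair 0 i
  | Cst i => cpair 1 i
  end.

Fixpoint qcode (k n : nat) (q : qf k n) : nat :=
  match q with
  | QTrue => cpair 0 0
  | QLt u v => cpair 1 (cpair (tcode u) (tcode v))
  | QEq u v => cpair 2 (cpair (tcode u) (tcode v))
  | QNot q1 => cpair 3 (qcode q1)
  | QAnd q1 q2 => cpair 4 (cpair (qcode q1) (qcode q2))
  | QOr q1 q2 => cpair 5 (cpair (qcode q1) (qcode q2))
  end.

(* [Sigma_index a i phi]: [i] is an index of [phi] as a computable Sigma formula
   of level the ordinal with notation [a].  The index <1, <a, <n, e>>> denotes
   the disjunction over all x = <m, j> in W_e of the formulas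
   "exists y_1 ... y_m, psi x" where [psi x] has index [j]; with tag 2 instead
   of 1, it denotes a conjunction of universally quantified formulas.  The
   notation [b x] of the level of [psi x] is recorded in the index [j]. *)
Inductive Sigma_index (k n : nat) : nat -> nat -> form k n -> Prop :=
| Sigma_index_qf (q : qf k n) :
    Sigma_index 1 (cpair 0 (cpair n (qcode q))) (QF q)
| Sigma_index_or a e (b : nat -> nat)
    (psi : forall x : nat, form k (n + cleft x)) of
    a <> 1
  & (forall x, W e x -> klt (b x) a)
  & (forall x, W e x -> Pi_index (b x) (cright x) (psi x)) :
    Sigma_index a (cpair 1 (cpair a (cpair n e)))
      (Or (W e) (fun x => Ex (psi x)))
with Pi_index (k n : nat) : nat -> nat -> form k n -> Prop :=
| Pi_index_qf (q : qf k n) :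
    Pi_index 1 (cpair 0 (cpair n (qcode q))) (QF q)
| Pi_index_and a e (b : nat -> nat)
    (psi : forall x : nat, form k (n + cleft x)) of
    a <> 1
  & (forall x, W e x -> klt (b x) a)
  & (forall x, W e x -> Sigma_index (b x) (cright x) (psi x)) :
    Pi_index a (cpair 2 (cpair a (cpair n e)))
      (And (W e) (fun x => All (psi x))).

Definition cSigma_with_index (k : nat) (al : bord) (i : nat) : fclass k :=
  fun n phi =>
    exists a be, [/\ O_notation a be, oeq be al & Sigma_index a i phi].

Definition cPi_with_index (k : nat) (al : bord) (i : nat) : fclass k :=
  fun n phi =>
    exists a be, [/\ O_notation a be, oeq be al & Pi_index a i phi].

Definition is_cSigma (k : nat) (al : bord) : fclass k :=
  fun n phi => exists i, cSigma_with_index al i phi.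

Definition is_cPi (k : nat) (al : bord) : fclass k :=
  fun n phi => exists i, cPi_with_index al i phi.

Definition class_c (k : nat) (G : complexity) : fclass k :=
  match G with
  | CSigma al => is_cSigma al
  | CPi al => is_cPi al
  | CdSigma al => conj_class (is_cSigma al) (is_cPi al)
  end.

Definition is_computable_SSC (A : structure 0) (G : complexity) : Prop :=
  is_complexity (@class_c 0) A G.

Definition has_ce_cSigma_scott_family (A : structure 0) (al : bord) : Prop :=
  exists S : nat -> Prop,
    [/\ ce S,
        forall i, S i -> exists n (phi : form 0 n), cSigma_with_index al i phi
      & scott_family A
          (fun n phi => exists i, S i /\ cSigma_with_index al i phi)].

(** * The canonical copy *)

Inductive node : Type :=
| NRoot
| NA (k j : nat)
| NB (j : nat)
| NAchild (k j i : nat)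
| NBchild (j i : nat).

(* A bijection of the natural numbers with the nodes of the tree.  There is a
   node [NAchild k j i] only for 1 <= i <= k; writing k = p + i shows that these
   nodes are indexed by the triples <<p, i - 1>, j>. *)
Definition node_of (x : nat) : node :=
  match x with
  | 0 => NRoot
  | y.+1 =>
      let q := cright y in
      match cleft y with
      | 0 => NA (cleft q) (cright q)
      | 1 => NB q
      | 2 =>
          let p := cleft (cleft q) in
          let i := (cright (cleft q)).+1 in
          NAchild (p + i) (cright q) i
      | j.+3 => NBchild j q
      end
  end.

Definition node_prec (u v : node) : Prop :=
  match u, v with
  | NRoot, NRoot => False
  | NRoot, _ => True
  | NA k j, NAchild k' j' _ => k = k' /\ j = j'
  | NB j, NBchild j' _ => j = j'
  | _, _ => False
  end.

Definition canonical_A2 : structure 0 :=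
  @Structure 0 nat (fun x y => node_prec (node_of x) (node_of y))
    [tuple of [::]] (inhabits 0).

Definition computable_rel (R : nat -> nat -> Prop) : Prop :=
  exists c : code, forall x y : nat,
    (R x y /\ eval c (cpair x y) 1) \/ (~ R x y /\ eval c (cpair x y) 0).

(* Main.v *)
Require Import Defs.
From mathcomp Require Import all_boot zify.
From Stdlib Require Import Classical ClassicalEpsilon.
From Stdlib Require List FinFun Cantor.

Set Implicit Arguments.
Unset Strict Implicit.
Unset Printing Implicit Defensive.

(** Call the number of elements above a node of a tree of height at most two
    its degree.  In a tree in which every degree in omega or equal to omega is
    realized by infinitely many level-one nodes ([rich]), a finite partial map
    that preserves the order and the degrees and is closed under predecessors
    can be extended back and forth.  So all countable rich trees are
    isomorphic, and the orbit of a tuple is determined by the order and the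
    degrees on the closure of the tuple under predecessors ([rich_iso]).

    Upper bounds.  That the degree of x is at least m is an existential
    condition on x.  Hence being a copy of a given finite part of the tree,
    closed under predecessors and with its degrees, is a conjunction of Sigma_1
    and Pi_1 conditions, which is Pi_2 ([diagram_Pi2]).  Quantifying the part
    existentially gives Sigma_3 formulas that define the orbits
    ([realized_orbit]).  The conjunction, over all finite parts, of the
    sentences saying that a copy of the part exists is a Pi_4 Scott sentence:
    its models are rich ([diagrams_rich]).  The conjuncts are explicit, so
    indices of all these formulas are computable by s-m-n ([ce_ranges],
    [repP_family]).

    Lower bounds.  A Pi_1 formula is preserved when degrees may drop, because
    a finite configuration around the new tuple still embeds around the old
    one ([Pi1_transfer]).  As existential witnesses are finite tuples, a node
    of large finite degree can therefore replace a node of infinite degree in a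
    true Sigma_2 formula ([Sigma2_transfer]).  Two consequences follow.  First,
    a Sigma_2 formula, with any parameters, that holds of a fresh node of
    infinite degree holds of some node of finite degree
    ([Sigma2_finite_degree]); so the orbit of infinite-degree nodes is not
    Sigma_2-definable and both Scott ranks are at least 3.  Secondly, Pi_3
    formulas are preserved from the rich tree to any tree that still has
    infinitely many nodes of each finite degree, along maps preserving degrees
    ([Pi3_transfer]).  Given a finite tuple of parameters one may keep only
    finitely many infinite degrees, among them those met by the tuple
    ([tree_companion]); the result is not isomorphic to the rich tree and
    satisfies the same Pi_3 formulas at the tuple, so no Sigma_4 sentence, and
    no conjunction of a Sigma_4 and a Pi_3 sentence, is a Scott sentence.
    Computable formulas are formulas of the same level ([class_c_in]), which
    carries the bounds over to the computable hierarchy. *)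

(** * Lists *)

Lemma In_mem (T : eqType) (x : T) (s : seq T) : List.In x s <-> x \in s.
Proof.
elim: s => [|y s IH] //=; rewrite in_cons; split.
  by case=> [->|/IH ->]; rewrite ?eqxx ?orbT.
by case/orP => [/eqP ->|/IH]; [left | right].
Qed.

Lemma In_consE T (a b : T) l : List.In a (b :: l) <-> b = a \/ List.In a l.
Proof. by []. Qed.

Lemma In_cat T (a : T) s t : List.In a (s ++ t) <-> List.In a s \/ List.In a t.
Proof. exact: List.in_app_iff. Qed.

Lemma list_bound (L : seq nat) : exists N, forall x, List.In x L -> x < N.
Proof.
elim: L => [|x L [N HN]]; first by exists 0.
exists (maxn x.+1 N) => y [<-|/HN]; lia.
Qed.

Lemma NoDup_incl_size (T : Type) (s l : seq T) :
  List.NoDup s -> List.incl s l -> size s <= size l.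
Proof. by move=> nd i; apply/leP; apply: List.NoDup_incl_length. Qed.

Lemma size_map_seq (T : Type) (f : nat -> T) n : size (List.map f (List.seq 0 n)) = n.
Proof. by have := List.length_map f (List.seq 0 n); rewrite List.length_seq. Qed.

Lemma pigeonhole (T : Type) (f : nat -> T) (L : seq T) :
  (forall i j, i <= size L -> j <= size L -> f i = f j -> i = j) ->
  exists i, i <= size L /\ ~ List.In (f i) L.
Proof.
move=> fi; apply: NNPP => NE.
suff : size (List.map f (List.seq 0 (size L).+1)) <= size L by rewrite size_map_seq ltnn.
apply: NoDup_incl_size.
  apply: List.NoDup_map_NoDup_ForallPairs; last exact: List.seq_NoDup.
  by move=> i j /List.in_seq hi /List.in_seq hj; apply: fi; lia.
move=> y /List.in_map_iff [i [<- /List.in_seq hi]]; apply: NNPP => Ni.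
by apply: NE; exists i; split=> //; lia.
Qed.

(** * Ordinal notations *)

Lemma ole_lim a f n : ole a (f n) -> ole a (blim f).
Proof.
elim: a => [|a _|g IH] //=; first by exists n.
by move=> H m; apply: IH.
Qed.

Lemma ole_refl a : ole a a.
Proof. by elim: a => [|a IH|f IH] //= n; apply: ole_lim (IH n). Qed.

Lemma ole_trans b a c : ole a b -> ole b c -> ole a c.
Proof.
elim: a b c => [|a IH|f IH] b c //; last first.
  by move=> Hf Hbc n; apply: IH (Hf n) Hbc.
elim: b => [|b _|g IHg] //=.
  move=> ab; elim: c => [|c _|h IHh] //=; first exact: IH.
  by case=> n Hn; exists n; apply: IHh.
by case=> n Hn Hg; apply: (IHg n).
Qed.

Lemma olt_le a b : olt a b -> ole a b.
Proof.
elim: a b => [|a IH|f IH] b //.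
  elim: b => [|b _|g IHg] //=; first by move=> ab; apply: IH.
  by case=> n Hn; exists n; apply: IHg.
elim: b => [|b _|g IHg] //.
  by move=> H n; apply: (IH n (bsucc b) (H n)).
by case=> m Hm; apply: (@ole_lim (blim f) g m); apply: IHg.
Qed.

Lemma olt_trans b a c : olt a b -> olt b c -> olt a c.
Proof. by move=> ab bc; apply: ole_trans ab _; apply: olt_le. Qed.

Lemma ole_lt_trans b a c : ole a b -> olt b c -> olt a c.
Proof. by move=> ab; apply: (@ole_trans (bsucc b) (bsucc a)). Qed.

(** Excluded middle enters at limits: one must decide whether some [f k] is
    already above the given finite ordinal. *)
Lemma bfin_total n a : ole (bfin n) a \/ olt a (bfin n).
Proof.
elim: n a => [|n IH] a; first by left.
elim: a => [|a _|f IHf]; first by right.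
  by case: (IH a); [left | right].
have [[k Hk]|H] := classic (exists k, ole (bfin n.+1) (f k)).
  by left; apply: ole_lim Hk.
right; change (forall k, ole (f k) (bfin n)) => k.
case: (IHf k) => // Hk; by case: H; exists k.
Qed.

(** * Trees of height at most two *)

(** With chains of length at most three, sets of predecessors are finite
    without further ado; so being a tree of height at most two with root r is
    expressed here by universal conditions on r, fit for one Pi_1 formula. *)
Record shallow (T : Type) (R : T -> T -> Prop) (r : T) : Prop := Shallow {
  sh_irr : forall x, ~ R x x;
  sh_trans : forall x y z, R x y -> R y z -> R x z;
  sh_lin : forall x y z, R y x -> R z x -> [\/ R y z, y = z | R z y];
  sh_hgt : forall x y z w, R x y -> R y z -> R z w -> False;
  sh_root : forall x, x = r \/ R r x
}.

(** The existence of a finite list, rather than a cardinality, keeps the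
    condition existential; it also makes sense for the root and for leaves. *)
Definition above (T : Type) (R : T -> T -> Prop) (x : T) (m : nat) : Prop :=
  exists w : seq T, [/\ List.NoDup w, size w = m & forall y, List.In y w -> R x y].

Definition deg_is (T : Type) (R : T -> T -> Prop) (x : T) (c : option nat) : Prop :=
  forall m, above R x m <-> if c is Some d then m <= d else True.

Definition lev1 (T : Type) (R : T -> T -> Prop) (r x : T) : Prop :=
  R r x /\ forall z, R z x -> z = r.

Definition realizes (T : Type) (R : T -> T -> Prop) (r : T) (c : option nat) : Prop :=
  forall L : seq T, exists y, [/\ lev1 R r y, ~ List.In y L & deg_is R y c].

(** Countability aside, this characterizes the tree of the theorem. *)
Definition rich (T : Type) (R : T -> T -> Prop) (r : T) : Prop :=
  shallow R r /\ forall c, realizes R r c.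

Section Above.
Variables (T : Type) (R : T -> T -> Prop).

Lemma above0 x : above R x 0.
Proof. by exists [::]; split => //; constructor. Qed.

Lemma above_le x m n : m <= n -> above R x n -> above R x m.
Proof.
move=> mn [w [Hw sw H]]; exists (take m w); split.
- by move: Hw; rewrite -{1}(cat_take_drop m w) => /List.NoDup_app_remove_r.
- by rewrite size_takel ?sw.
- by move=> y Hy; apply: H; rewrite -(cat_take_drop m w); apply: List.in_or_app; left.
Qed.

Lemma deg_exists x : exists c, deg_is R x c.
Proof.
have [H|] := classic (forall m, above R x m); first by exists None.
move=> /not_all_ex_not [m Hm].
suff [d [Hd Hd']] : exists d, above R x d /\ ~ above R x d.+1.
  exists (Some d) => k; split=> [Hk|kd]; last by apply: above_le Hd.
  by rewrite leqNgt; apply/negP=> dk; apply: Hd'; apply: above_le Hk.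
elim: m Hm => [|m IH] Hm; first by case: Hm; apply: above0.
by have [Ha|/IH] := classic (above R x m); first by exists m.
Qed.

Variable r : T.
Hypothesis sh : shallow R r.

Lemma root_min x : ~ R x r.
Proof.
move=> Hx; case: (sh_root sh x) => [xr|/(sh_trans sh)/(_ Hx)]; last exact: sh_irr sh _.
by move: Hx; rewrite xr; apply: sh_irr sh _.
Qed.

Lemma above_chain x y z : R r x -> R x y -> ~ R y z.
Proof. by move=> a b c; apply: sh_hgt sh _ _ _ _ a b c. Qed.

Lemma shallow_cases x :
  [\/ x = r, lev1 R r x | exists p, lev1 R r p /\ R p x].
Proof.
case: (sh_root sh x) => [->|rx]; first by constructor 1.
have [[p [rp px]]|H] := classic (exists p, R r p /\ R p x).
  constructor 3; exists p; split=> //; split=> // z zp.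
  case: (sh_root sh z) => // rz; case: (above_chain rz zp px).
constructor 2; split=> // z zx; case: (sh_root sh z) => // rz.
by case: H; exists z.
Qed.

Lemma lev2_pred p x z : lev1 R r p -> R p x -> R z x -> z = r \/ z = p.
Proof.
move=> [rp Hp] px zx; case: (sh_lin sh zx px) => [/Hp|->|pz]; [by left|by right|].
by case: (above_chain rp pz zx).
Qed.

(** Hence two nodes of level two never have different degrees, and extending
    a partial map to leaves meets no condition on degrees. *)
Lemma lev2_leaf p x : lev1 R r p -> R p x -> deg_is R x (Some 0).
Proof.
move=> [rp _] px m; rewrite leqn0; split=> [|/eqP ->]; last exact: above0.
by case=> [[|y w] [_ <- //]] /(_ y (or_introl erefl)) /(above_chain rp px).
Qed.

End Above.

(** * Finite partial maps *)

(** Closure under predecessors, on both sides, is what makes it possible to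
    send a new level-one node to any new level-one node: no element of the map
    can lie above either.  The relation D is the condition on degrees: equality
    to build isomorphisms, inequalities to transfer formulas. *)
Record part_map (S T : Type) (RS : S -> S -> Prop) (RT : T -> T -> Prop) (rS : S) (rT : T)
    (D : S -> T -> Prop) (l : seq (S * T)) : Prop := PartMap {
  pm_root : List.In (rS, rT) l;
  pm_eq : forall x x' y y', List.In (x, y) l -> List.In (x', y') l -> (x = x' <-> y = y');
  pm_rel : forall x x' y y', List.In (x, y) l -> List.In (x', y') l -> (RS x x' <-> RT y y');
  pm_deg : forall x y, List.In (x, y) l -> D x y;
  pm_cl1 : forall x y z, List.In (x, y) l -> RS z x -> exists z', List.In (z, z') l;
  pm_cl2 : forall x y z, List.In (x, y) l -> RT z y -> exists z', List.In (z', z) l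
}.

Lemma part_map_weaken S T RS RT rS rT (D D' : S -> T -> Prop) l :
  (forall x y, D x y -> D' x y) ->
  part_map RS RT rS rT D l -> part_map RS RT rS rT D' l.
Proof. by move=> DD' [H1 H2 H3 H4 H5 H6]; split=> // x y /H4 /DD'. Qed.

Definition swap_pair (S T : Type) (p : S * T) : T * S := (p.2, p.1).

Lemma In_swap S T (l : seq (S * T)) x y :
  List.In (y, x) (List.map (@swap_pair S T) l) <-> List.In (x, y) l.
Proof.
rewrite List.in_map_iff; split; first by case=> [[a b] [[<- <-]]].
by move=> H; exists (x, y).
Qed.

Lemma part_map_swap S T RS RT rS rT (D : S -> T -> Prop) l :
  part_map RS RT rS rT D l ->
  part_map RT RS rT rS (fun y x => D x y) (List.map (@swap_pair S T) l).
Proof.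
move=> [H1 H2 H3 H4 H5 H6]; split.
- by apply/In_swap.
- by move=> x x' y y' /In_swap a /In_swap b; split=> /(H2 _ _ _ _ a b).
- by move=> x x' y y' /In_swap a /In_swap b; split=> /(H3 _ _ _ _ a b).
- by move=> x y /In_swap; apply: H4.
- by move=> x y z /In_swap /H6 H /H [z' Hz]; exists z'; apply/In_swap.
- by move=> x y z /In_swap /H5 H /H [z' Hz]; exists z'; apply/In_swap.
Qed.

Section Forth.
Variables (S T : Type) (RS : S -> S -> Prop) (RT : T -> T -> Prop) (rS : S) (rT : T).
Hypotheses (shS : shallow RS rS) (shT : shallow RT rT).
Variable D : S -> T -> Prop.

Local Notation pmap := (part_map RS RT rS rT D).

Lemma pm_root_iff l x y : pmap l -> List.In (x, y) l -> (x = rS <-> y = rT).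
Proof. by move=> pm Hl; apply: (pm_eq pm Hl (pm_root pm)). Qed.

Lemma pm_lev1 l x y : pmap l -> List.In (x, y) l -> lev1 RS rS x -> lev1 RT rT y.
Proof.
move=> pm Hl [rx Hx]; split; first by apply/(pm_rel pm (pm_root pm) Hl).
move=> z zy; have [z' Hz] := pm_cl2 pm Hl zy.
by apply/(pm_root_iff pm Hz); apply: Hx; apply/(pm_rel pm Hz Hl).
Qed.

Lemma pm_add l x y :
  pmap l -> D x y ->
  ~ (exists y', List.In (x, y') l) -> ~ (exists x', List.In (x', y) l) ->
  (forall x' y', List.In (x', y') l -> (RS x' x <-> RT y' y)) ->
  (forall z, RS z x -> exists z', List.In (z, z') l) ->
  (forall z, RT z y -> exists z', List.In (z', z) l) ->
  pmap ((x, y) :: l).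
Proof.
move=> pm Dxy Nx Ny Hrel c1 c2; split.
- by right; apply: (pm_root pm).
- move=> u u' v v' /In_consE [[<- <-]|Hu] /In_consE [[<- <-]|Hv].
  + by [].
  + by split=> E; [case: Nx; rewrite E; exists v' | case: Ny; rewrite E; exists u'].
  + by split=> E; [case: Nx; rewrite -E; exists v | case: Ny; rewrite -E; exists u].
  + exact: (pm_eq pm Hu Hv).
- move=> u u' v v' /In_consE [[<- <-]|Hu] /In_consE [[<- <-]|Hv].
  + by split=> [/(sh_irr shS)|/(sh_irr shT)].
  + by split=> [/(pm_cl1 pm Hv) /Nx|/(pm_cl2 pm Hv) /Ny].
  + by apply: iff_trans (Hrel _ _ Hu) _.
  + exact: (pm_rel pm Hu Hv).
- by move=> u v /In_consE [[<- <-]|] //; apply: (pm_deg pm).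
- move=> u v z /In_consE [[<- _] /c1|/(pm_cl1 pm) H /H] [z' Hz]; exists z'; by right.
- move=> u v z /In_consE [[_ <-] /c2|/(pm_cl2 pm) H /H] [z' Hz]; exists z'; by right.
Qed.

Lemma pm_add_lev1 l x y :
  pmap l -> lev1 RS rS x -> lev1 RT rT y -> D x y ->
  ~ (exists y', List.In (x, y') l) -> ~ (exists x', List.In (x', y) l) ->
  pmap ((x, y) :: l).
Proof.
move=> pm [rx Hx] [ry Hy] Dxy Nx Ny; apply: pm_add => //.
- move=> x' y' H'; split=> [/Hx E|/Hy E].
    by move: ry; congr (RT _ _); symmetry; apply/(pm_root_iff pm H').
  by move: rx; congr (RS _ _); symmetry; apply/(pm_root_iff pm H').
- by move=> z /Hx ->; exists rT; apply: (pm_root pm).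
- by move=> z /Hy ->; exists rS; apply: (pm_root pm).
Qed.

(* Preservation of degrees up to K suffices for maps with fewer than K pairs:
   a node has at most as many children in the map as there are pairs. *)
Variable K : nat.
Hypothesis D_above : forall x y, D x y -> forall m, m <= K -> above RS x m -> above RT y m.
Hypothesis D_leaf : forall x y, deg_is RS x (Some 0) -> deg_is RT y (Some 0) -> D x y.
Hypothesis D_lev1 : forall x (L : seq T), lev1 RS rS x ->
  exists y, [/\ lev1 RT rT y, ~ List.In y L & D x y].

(** The children of p in the map, together with x, show that p has more
    children than the map uses; then so has p', and one of them is unused. *)
Lemma fresh_child l p p' x :
  pmap l -> List.In (p, p') l -> size l < K ->
  RS p x -> ~ (exists y', List.In (x, y') l) ->
  exists y, RT p' y /\ ~ (exists x', List.In (x', y) l).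
Proof.
move=> pm Hp lK px Nx.
pose dec (a b : S * T) := excluded_middle_informative (a = b).
pose q (a : S * T) := if excluded_middle_informative (RS p a.1) then true else false.
pose l2 := List.nodup dec (List.filter q l).
have in_l2 a : List.In a l2 <-> List.In a l /\ RS p a.1.
  rewrite List.nodup_In List.filter_In /q.
  by case: excluded_middle_informative => ?; split=> [] [].
have nd1 : List.NoDup (x :: List.map fst l2).
  constructor.
    by move=> /List.in_map_iff [[a b] /= [-> /in_l2 [H _]]]; apply: Nx; exists b.
  apply: List.NoDup_map_NoDup_ForallPairs; last exact: List.NoDup_nodup.
  move=> [a b] [a' b'] /in_l2 [Ha _] /in_l2 [Hb _] /= E.
  by congr pair => //; apply/(pm_eq pm Ha Hb).
have s2 : size l2 <= size l.
  apply: NoDup_incl_size; first exact: List.NoDup_nodup.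
  by move=> a /in_l2 [].
have : above RT p' (size l2).+1.
  apply: (D_above (pm_deg pm Hp)); first lia.
  exists (x :: List.map fst l2); split=> //.
    by rewrite /=; congr _.+1; elim: (l2) => //= ? ? ->.
  by move=> y [<- //|/List.in_map_iff [a [<- /in_l2 []]]].
case=> w [ndw sw Hw].
have [[y [yw yl]]|H] := classic (exists y, List.In y w /\ ~ List.In y (List.map snd l2)).
  exists y; split; first exact: Hw.
  case=> x' Hx'; apply: yl; apply/List.in_map_iff; exists (x', y); split=> //.
  apply/in_l2; split=> //=; apply/(pm_rel pm Hp Hx'); exact: Hw.
have : (size w <= size (List.map snd l2))%coq_nat.
  apply: List.NoDup_incl_length => // y yw; apply: NNPP => Hy; by apply: H; exists y.
have -> : size (List.map snd l2) = size l2 by elim: (l2) => //= ? ? ->.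
by move/leP; rewrite sw ltnn.
Qed.

Lemma forth_le1 l x :
  pmap l -> (x = rS \/ lev1 RS rS x) ->
  exists l', [/\ pmap l', List.incl l l', size l' <= (size l).+1 &
                 exists y, List.In (x, y) l'].
Proof.
move=> pm Hx.
have [Hin|Nin] := classic (exists y, List.In (x, y) l).
  by exists l; split=> //; apply: List.incl_refl.
case: Hx => [E|Hx]; first by case: Nin; exists rT; rewrite E; apply: (pm_root pm).
have [y [Hy Ny Dxy]] := D_lev1 (List.map snd l) Hx.
exists ((x, y) :: l); split=> //; last by exists y; left.
  apply: pm_add_lev1 => // -[x' Hx']; apply: Ny.
  by apply/List.in_map_iff; exists (x', y).
exact: List.incl_tl (List.incl_refl _).
Qed.

(** Two pairs may be needed: the parent of x must enter the map before x. *)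
Lemma forth l x :
  pmap l -> size l + 2 <= K ->
  exists l', [/\ pmap l', List.incl l l', size l' <= size l + 2 &
                 exists y, List.In (x, y) l'].
Proof.
move=> pm lK; case: (shallow_cases shS x) => [Hx|Hx|[p [Hp px]]].
- have [l' [? ? ? ?]] := forth_le1 pm (or_introl Hx); exists l'; split=> //; lia.
- have [l' [? ? ? ?]] := forth_le1 pm (or_intror Hx); exists l'; split=> //; lia.
have [l1 [pm1 inc1 s1 [p' Hp']]] := forth_le1 pm (or_intror Hp).
have [Hin|Nin] := classic (exists y, List.In (x, y) l1).
  by exists l1; split=> //; lia.
have [|y [py Ny]] := fresh_child pm1 Hp' _ px Nin; first by lia.
have Hq := pm_lev1 pm1 Hp' Hp.
exists ((x, y) :: l1); split=> //; last by exists y; left.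
- apply: pm_add => //.
  + by apply: D_leaf; [apply: (lev2_leaf shS Hp px) | apply: (lev2_leaf shT Hq py)].
  + move=> x' y' H'; split=> [/(lev2_pred shS Hp px)|/(lev2_pred shT Hq py)] [E|E].
    * have -> : y' = rT by apply/(pm_root_iff pm1 H').
      by apply: sh_trans shT _ _ _ _ py; case: Hq.
    * by have -> : y' = p' by apply/(pm_eq pm1 H' Hp').
    * have -> : x' = rS by apply/(pm_root_iff pm1 H').
      by apply: sh_trans shS _ _ _ _ px; case: Hp.
    * by have -> : x' = p by apply/(pm_eq pm1 H' Hp').
  + move=> z /(lev2_pred shS Hp px) [->|->]; last by exists p'.
    by exists rT; apply: (pm_root pm1).
  + move=> z /(lev2_pred shT Hq py) [->|->]; last by exists p.
    by exists rS; apply: (pm_root pm1).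
- exact: List.incl_tl.
- rewrite /=; lia.
Qed.

Lemma forth_seq l (xs : seq S) :
  pmap l -> size l + 2 * size xs <= K ->
  exists l', [/\ pmap l', List.incl l l', size l' <= size l + 2 * size xs &
                 forall x, List.In x xs -> exists y, List.In (x, y) l'].
Proof.
elim: xs l => [|x xs IH] l pm lK.
  by exists l; split=> //; rewrite ?addn0 //; apply: List.incl_refl.
rewrite /= in lK.
have [|l1 [pm1 i1 s1 [y Hy]]] := forth x pm; first by lia.
have [|l2 [pm2 i2 s2 H2]] := IH l1 pm1; first by lia.
exists l2; split=> //.
- exact: List.incl_tran i1 i2.
- rewrite /=; lia.
- move=> x' [<-|/H2 //]; exists y; exact: i2.
Qed.

End Forth.

(** * Isomorphisms by back and forth *)

(** The injections into nat schedule the construction: the n-th step puts the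
    elements numbered n on either side into the map. *)
Lemma back_and_forth (S T : Type) (P : seq (S * T) -> Prop) (fS : S -> nat) (fT : T -> nat)
    (l0 : seq (S * T)) :
  injective fS -> injective fT ->
  (forall l x y x' y', P l -> List.In (x, y) l -> List.In (x', y') l -> (x = x' <-> y = y')) ->
  (forall l x, P l -> exists l', [/\ P l', List.incl l l' & exists y, List.In (x, y) l']) ->
  (forall l y, P l -> exists l', [/\ P l', List.incl l l' & exists x, List.In (x, y) l']) ->
  P l0 ->
  exists f : S -> T, [/\ bijective f,
    forall x y, List.In (x, y) l0 -> f x = y &
    forall x x', exists l, [/\ P l, List.In (x, f x) l & List.In (x', f x') l]].
Proof.
move=> iS iT Peq Pforth Pback P0.
have ex_forth l n : P l -> exists l', [/\ P l', List.incl l l' &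
    forall x, fS x = n -> exists y, List.In (x, y) l'].
  move=> Pl; have [[x Hx]|N] := classic (exists x, fS x = n); last first.
    by exists l; split=> // x Hx; case: N; exists x.
  have [l' [P' i' H']] := Pforth l x Pl.
  by exists l'; split=> // x' E; rewrite -Hx in E; rewrite (iS _ _ E).
have ex_back l n : P l -> exists l', [/\ P l', List.incl l l' &
    forall y, fT y = n -> exists x, List.In (x, y) l'].
  move=> Pl; have [[x Hx]|N] := classic (exists x, fT x = n); last first.
    by exists l; split=> // x Hx; case: N; exists x.
  have [l' [P' i' H']] := Pback l x Pl.
  by exists l'; split=> // x' E; rewrite -Hx in E; rewrite (iT _ _ E).
have ex_step (n : nat) (l : {l | P l}) : exists l' : {l | P l}, [/\ List.incl (sval l) (sval l'),
    forall x, fS x = n -> exists y, List.In (x, y) (sval l') &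
    forall y, fT y = n -> exists x, List.In (x, y) (sval l')].
  have [l1 [P1 i1 H1]] := ex_forth _ n (svalP l).
  have [l2 [P2 i2 H2]] := ex_back _ n P1.
  exists (exist _ l2 P2); split=> //=; first exact: List.incl_tran i1 i2.
  by move=> x /H1 [y Hy]; exists y; apply: i2.
pose step n l := sval (constructive_indefinite_description _ (ex_step n l)).
have stepP n l := svalP (constructive_indefinite_description _ (ex_step n l)).
pose L := fix L n := if n is n'.+1 then step n' (L n') else exist P l0 P0.
have Lmono m n : m <= n -> List.incl (sval (L m)) (sval (L n)).
  elim: n => [|n IH].
    by rewrite leqn0 => /eqP ->; apply: List.incl_refl.
  rewrite leq_eqVlt => /orP[/eqP ->|]; first exact: List.incl_refl.
  rewrite ltnS => /IH H; apply: List.incl_tran H _.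
  by case: (stepP n (L n)).
have exf x : exists y, List.In (x, y) (sval (L (fS x).+1)).
  by case: (stepP (fS x) (L (fS x))) => _ H _; apply: H.
have exg y : exists x, List.In (x, y) (sval (L (fT y).+1)).
  by case: (stepP (fT y) (L (fT y))) => _ _ H; apply: H.
pose f x := sval (constructive_indefinite_description _ (exf x)).
have fP x : List.In (x, f x) (sval (L (fS x).+1)).
  exact: (svalP (constructive_indefinite_description _ (exf x))).
pose g y := sval (constructive_indefinite_description _ (exg y)).
have gP y : List.In (g y, y) (sval (L (fT y).+1)).
  exact: (svalP (constructive_indefinite_description _ (exg y))).
have Leq m n x y x' y' : List.In (x, y) (sval (L m)) -> List.In (x', y') (sval (L n)) ->
    (x = x' <-> y = y').
  move=> Hm Hn; apply: (Peq _ _ _ _ _ (svalP (L (maxn m n)))).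
    exact: Lmono (leq_maxl _ _) _ Hm.
  exact: Lmono (leq_maxr _ _) _ Hn.
exists f; split.
- exists g.
    by move=> x; apply/(Leq _ _ _ _ _ _ (gP (f x)) (fP x)).
  by move=> y; apply/(Leq _ _ _ _ _ _ (fP (g y)) (gP y)).
- by move=> x y Hxy; apply/(Leq _ 0 _ _ _ _ (fP x) Hxy).
- move=> x x'; exists (sval (L (maxn (fS x).+1 (fS x').+1))); split.
  + exact: svalP.
  + exact: Lmono (leq_maxl _ _) _ (fP x).
  + exact: Lmono (leq_maxr _ _) _ (fP x').
Qed.

Definition same_deg (S T : Type) (RS : S -> S -> Prop) (RT : T -> T -> Prop) (x : S) (y : T) :=
  forall m, above RS x m <-> above RT y m.

Lemma deg_is_same S T (RS : S -> S -> Prop) (RT : T -> T -> Prop) x y c :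
  deg_is RS x c -> deg_is RT y c -> same_deg RS RT x y.
Proof. by move=> H1 H2 m; rewrite H1 H2. Qed.

Lemma forth_same S T (RS : S -> S -> Prop) (RT : T -> T -> Prop) rS rT l (xs : seq S) :
  shallow RS rS -> rich RT rT ->
  part_map RS RT rS rT (same_deg RS RT) l ->
  exists l', [/\ part_map RS RT rS rT (same_deg RS RT) l', List.incl l l' &
    forall x, List.In x xs -> exists y, List.In (x, y) l'].
Proof.
move=> shS [shT ri] pm.
have [|||l' [? ? _ ?]] := @forth_seq S T RS RT rS rT shS shT (same_deg RS RT)
  (size l + 2 * size xs) _ _ _ l xs pm (leqnn _).
- by move=> x y H m _; apply: (proj1 (H m)).
- by move=> x y; apply: deg_is_same.
- move=> x L _; have [c Hc] := deg_exists RS x.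
  by have [y [? ? ?]] := ri c L; exists y; split=> //; apply: deg_is_same Hc _.
- by exists l'.
Qed.

Lemma same_degC S T (RS : S -> S -> Prop) (RT : T -> T -> Prop) x y :
  same_deg RS RT x y -> same_deg RT RS y x.
Proof. by move=> H m; rewrite H. Qed.

Lemma part_map_swap_same S T (RS : S -> S -> Prop) (RT : T -> T -> Prop) rS rT l :
  part_map RS RT rS rT (same_deg RS RT) l ->
  part_map RT RS rT rS (same_deg RT RS) (List.map (@swap_pair S T) l).
Proof. by move=> pm; apply: part_map_weaken (part_map_swap pm) => y x; apply: same_degC. Qed.

Lemma rich_iso S T (RS : S -> S -> Prop) (RT : T -> T -> Prop) rS rT l :
  countable S -> countable T -> rich RS rS -> rich RT rT ->
  part_map RS RT rS rT (same_deg RS RT) l ->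
  exists f : S -> T, [/\ bijective f, forall x y, RS x y <-> RT (f x) (f y) &
    forall x y, List.In (x, y) l -> f x = y].
Proof.
move=> [fS iS] [fT iT] riS riT pm.
have [|||f [bf fl fR]] := back_and_forth iS iT _ _ _ pm.
- by move=> l1 x y x' y' pm1; apply: (pm_eq pm1).
- move=> l1 x pm1; have [l' [? ? H]] := forth_same [:: x] (proj1 riS) riT pm1.
  by exists l'; split=> //; apply: H; left.
- move=> l1 y pm0; have pm1 := part_map_swap_same pm0.
  have [l' [pm' i' H]] := forth_same [:: y] (proj1 riT) riS pm1.
  exists (List.map (@swap_pair T S) l'); split.
  + exact: part_map_swap_same.
  + by move=> [a b] Hab; apply/In_swap; apply: i'; apply/In_swap.
  + by have [|x Hx] := H y; [left | exists x; apply/In_swap].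
exists f; split=> // x y; have [l1 [pm1 Hx Hy]] := fR x y.
exact: (pm_rel pm1 Hx Hy).
Qed.

(** Identity maps on such lists are the starting points of transfers that fix
    given parameters. *)
Lemma closed_list T (R : T -> T -> Prop) r (xs : seq T) : shallow R r ->
  exists L, [/\ List.In r L, List.incl xs L &
    forall x z, List.In x L -> R z x -> List.In z L].
Proof.
move=> sh; elim: xs => [|x xs [L [Lr Lx Lc]]].
  exists [:: r]; split=> [||x z [<-|//] /(root_min sh) //]; first by left.
  by move=> ? [].
have [x1|[p [Hp px]]] : (x = r \/ lev1 R r x) \/ exists p, lev1 R r p /\ R p x.
    by case: (shallow_cases sh x) => H; [left; left|left; right|right].
  exists (x :: L); split; first by right.
    by move=> z [<-|/Lx ?]; [left | right].
  move=> z z' /In_consE [<-|Hz] zz; last by right; apply: Lc zz.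
  case: x1 => [E|[_ Hx]]; first by case: (root_min sh (x := z')); rewrite -E.
  by right; rewrite (Hx _ zz).
exists (x :: p :: L); split; first by right; right.
  by move=> z [<-|/Lx ?]; [left | right; right].
move=> z z' /In_consE [<-|/In_consE [<-|Hz]] zz.
- by case: (lev2_pred sh Hp px zz) => ->; [right; right | right; left].
- by case: Hp => _ Hp; rewrite (Hp _ zz); right; right.
- by right; right; apply: Lc zz.
Qed.

Lemma In_diag T (L : seq T) x y :
  List.In (x, y) (List.map (fun z => (z, z)) L) <-> x = y /\ List.In x L.
Proof.
rewrite List.in_map_iff; split; first by case=> z [[<- <-]].
by case=> <- H; exists x.
Qed.

(** * Transfer of formulas along finite partial maps *)

Definition paired (S T : Type) (l : seq (S * T)) n (t : n.-tuple S) (s : n.-tuple T) :=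
  forall i, List.In (tnth t i, tnth s i) l.

Lemma paired_incl S T (l l' : seq (S * T)) n (t : n.-tuple S) (s : n.-tuple T) :
  List.incl l l' -> paired l t s -> paired l' t s.
Proof. by move=> i H j; apply: i. Qed.

Lemma paired_swap S T (l : seq (S * T)) n (t : n.-tuple S) (s : n.-tuple T) :
  paired l t s -> paired (List.map (@swap_pair S T) l) s t.
Proof. by move=> H i; apply/In_swap. Qed.

Lemma paired_cat S T (l : seq (S * T)) n m (t : n.-tuple S) (s : n.-tuple T)
    (u : m.-tuple S) (v : m.-tuple T) :
  paired l t s -> paired l u v -> paired l (cat_tuple t u) (cat_tuple s v).
Proof.
by move=> H1 H2 i; case: (split_ordP i) => j ->; rewrite ?tnth_lshift ?tnth_rshift.
Qed.

Lemma paired_ex S T (l : seq (S * T)) m (u : m.-tuple S) :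
  (forall x, List.In x u -> exists y, List.In (x, y) l) ->
  exists v : m.-tuple T, paired l u v.
Proof.
move=> H; have H' (i : 'I_m) : exists y, List.In (tnth u i, y) l.
  apply: H; rewrite -[tval u]map_tnth_enum.
  by apply/List.in_map_iff; exists i; split=> //; apply/In_mem; rewrite mem_enum.
exists [tuple sval (constructive_indefinite_description _ (H' i)) | i < m] => i.
rewrite tnth_mktuple.
exact: (svalP (constructive_indefinite_description _ (H' i))).
Qed.

Section Transfer.
Variables (k : nat) (A B : structure k) (rA : A) (rB : B).
Local Notation RA := (@prec k A).
Local Notation RB := (@prec k B).

Lemma qsat_paired D l n (t : n.-tuple A) (s : n.-tuple B) (q : qf k n) :
  part_map RA RB rA rB D l -> paired l t s -> paired l (cst A) (cst B) ->
  (qsat t q <-> qsat s q).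
Proof.
move=> pm ts c; have tv u : List.In (Defs.tval t u, Defs.tval s u) l by case: u.
elim: q => [|u v|u v|q IH|q1 IH1 q2 IH2|q1 IH1 q2 IH2] /=; try tauto.
  exact: (pm_rel pm (tv u) (tv v)).
exact: (pm_eq pm (tv u) (tv v)).
Qed.

End Transfer.

Lemma is_Sigma_lt1 k n b (phi : form k n) :
  ole b bzero -> is_Sigma b phi -> exists q, phi = QF q.
Proof.
move=> b0; case: phi => //=; first by move=> q _; exists q.
by move=> J F [H _]; have := ole_trans H b0.
Qed.

Lemma olt_bfin b a n : olt b a -> ole a (bfin n.+1) -> ole b (bfin n).
Proof. by move=> ba an; apply: (ole_trans ba an). Qed.

Definition le_deg (S T : Type) (RS : S -> S -> Prop) (RT : T -> T -> Prop) (x : S) (y : T) :=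
  forall m, above RS x m -> above RT y m.

(** A counterexample around s in B is carried along the map, extended to it, to
    a counterexample around t in A. *)
Lemma Pi1_transfer k (A B : structure k) rA rB n (a : bord) (phi : form k n) t s l :
  rich (@prec k A) rA -> shallow (@prec k B) rB ->
  ole a (bfin 1) -> is_Pi a phi ->
  part_map (@prec k B) (@prec k A) rB rA (le_deg (@prec k B) (@prec k A)) l ->
  paired l s t -> paired l (cst B) (cst A) ->
  sat phi t -> sat phi s.
Proof.
move=> [shA riA] shB a1 Hphi pm st cc.
case: phi Hphi => //=; first by move=> q _; apply: (proj2 (qsat_paired q pm st cc)).
move=> J F [_ HF] HA i Ji; have {HF} := HF i Ji; have {HA} := HA i Ji.
case: (F i) => //= m psi HA [b [ba Hb]] v.
have [q E] := is_Sigma_lt1 (olt_bfin ba a1) Hb.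
have [|||l' [pm' i' _ Hl']] := @forth_seq _ _ _ _ rB rA shB shA
  (le_deg (@prec k B) (@prec k A)) (size l + 2 * size v) _ _ _ l v pm (leqnn _).
- by move=> x y H m' _; apply: H.
- by move=> x y Hx Hy m' /Hx /Hy.
- move=> x L _; have [c Hc] := deg_exists (@prec k B) x.
  by have [y [? ? Hy]] := riA c L; exists y; split=> // m' /Hc /Hy.
have [u Hu] := paired_ex Hl'.
have := HA u; rewrite E /=; apply: (proj2 (qsat_paired q pm' _ _)).
  by apply: paired_cat => //; apply: paired_incl st.
exact: paired_incl cc.
Qed.

(** Degrees may drop, but those at most K are kept and larger ones stay at least K. *)
Definition deg_upto (K : nat) (S T : Type) (RS : S -> S -> Prop) (RT : T -> T -> Prop)
    (x : S) (y : T) :=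
  le_deg RT RS y x /\ forall m, m <= K -> above RS x m -> above RT y m.

(** The witnesses found in A are imitated in B, infinite degrees being replaced
    by degree K; the inverse of the extended map raises degrees, so the Pi_1
    part is transferred by [Pi1_transfer].  The bound K0 makes room for the
    witnesses and their parents.  It is fixed before s and l, since these will
    be chosen according to K. *)
Lemma Sigma2_transfer k (A B : structure k) rA rB n (a : bord) (phi : form k n) t :
  rich (@prec k A) rA -> shallow (@prec k B) rB ->
  (forall d, realizes (@prec k B) rB (Some d)) ->
  ole a (bfin 2) -> is_Sigma a phi -> sat phi t ->
  exists K0, forall s l K,
    part_map (@prec k A) (@prec k B) rA rB (deg_upto K (@prec k A) (@prec k B)) l ->
    paired l t s -> paired l (cst A) (cst B) -> size l + K0 <= K -> sat phi s.
Proof.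
move=> riA shB reB a2 Hphi.
case: phi Hphi => //=.
  by move=> q _ Ht; exists 0 => s l K pm ts cc _; apply: (proj1 (qsat_paired q pm ts cc)).
move=> J F [_ HF] [i [Ji]]; have {HF} := HF i Ji.
case EF: (F i) => [| | | |m psi|] //= [b [ba Hb]] [u Hu].
exists (2 * size u) => s l K pm ts cc lK; exists i; split=> //; rewrite EF /=.
have [|||l' [pm' i' _ Hl']] := @forth_seq _ _ _ _ rA rB (proj1 riA) shB
  (deg_upto K (@prec k A) (@prec k B)) K _ _ _ l u pm lK.
- by move=> x y [].
- by move=> x y Hx Hy; split=> m' => [/Hy /Hx|_ /Hx /Hy].
- move=> x L _; have [[d|] Hc] := deg_exists (@prec k A) x.
    have [y [? ? Hy]] := reB d L; exists y; split=> //.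
    by split=> m' => [/Hy /Hc|_ /Hc /Hy].
  have [y [? ? Hy]] := reB K L; exists y; split=> //.
  by split=> m' => [_|m'K _]; [apply/Hc | apply/Hy].
have [v Hv] := paired_ex Hl'; exists v.
have pm2 := part_map_swap pm'.
have {}pm2 := part_map_weaken (D' := le_deg _ _) (fun y x => @proj1 _ _) pm2.
apply: (Pi1_transfer riA shB (olt_bfin ba a2) Hb pm2 _ _ Hu).
  by apply: paired_swap; apply: paired_cat Hv; apply: paired_incl ts.
by apply: paired_swap; apply: paired_incl cc.
Qed.

Lemma Sigma2_transfer_same k (A B : structure k) rA rB n (a : bord) (phi : form k n) t s l :
  rich (@prec k A) rA -> shallow (@prec k B) rB ->
  (forall d, realizes (@prec k B) rB (Some d)) ->
  ole a (bfin 2) -> is_Sigma a phi ->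
  part_map (@prec k A) (@prec k B) rA rB (same_deg (@prec k A) (@prec k B)) l ->
  paired l t s -> paired l (cst A) (cst B) -> sat phi t -> sat phi s.
Proof.
move=> riA shB reB a2 Hphi pm ts cc Ht.
have [K0 H] := Sigma2_transfer riA shB reB a2 Hphi Ht.
apply: (H s l (size l + K0)) => //.
by apply: part_map_weaken pm => x y Hxy; split=> m => [/Hxy|_ /Hxy].
Qed.

(** An element of B is first matched in A, which has all degrees; the Sigma_2
    formula then true in A comes back to B by [Sigma2_transfer_same]. *)
Lemma Pi3_transfer k (A B : structure k) rA rB n (a : bord) (phi : form k n) t s l :
  rich (@prec k A) rA -> shallow (@prec k B) rB ->
  (forall d, realizes (@prec k B) rB (Some d)) ->
  ole a (bfin 3) -> is_Pi a phi ->
  part_map (@prec k A) (@prec k B) rA rB (same_deg (@prec k A) (@prec k B)) l ->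
  paired l t s -> paired l (cst A) (cst B) -> sat phi t -> sat phi s.
Proof.
move=> riA shB reB a3 Hphi pm ts cc.
case: phi Hphi => //=; first by move=> q _; apply: (proj1 (qsat_paired q pm ts cc)).
move=> J F [_ HF] HA i Ji; have {HF} := HF i Ji; have {HA} := HA i Ji.
case: (F i) => //= m psi HA [b [ba Hb]] v.
have [l' [pm' i' H']] := forth_same v shB riA (part_map_swap_same pm).
have [u Hu] := paired_ex H'.
have pm2 := part_map_swap_same pm'.
apply: (Sigma2_transfer_same riA shB reB (olt_bfin ba a3) Hb pm2 _ _ (HA u)).
  apply: paired_cat; last exact: paired_swap.
  by apply: paired_swap; apply: paired_incl i' _; apply: paired_swap.
by apply: paired_swap; apply: paired_incl i' _; apply: paired_swap.
Qed.

(** The node x is taken outside a closed list containing the constants, and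
    replaced by a node y of degree K outside it, with K large enough for the
    witnesses of the formula at x. *)
Lemma Sigma2_finite_degree k (A : structure k) rA :
  rich (@prec k A) rA ->
  exists x : A, [/\ lev1 (@prec k A) rA x, deg_is (@prec k A) x None &
    forall a (phi : form k 1), ole a (bfin 2) -> is_Sigma a phi -> sat phi [tuple x] ->
    exists y, ~ deg_is (@prec k A) y None /\ sat phi [tuple y]].
Proof.
move=> ri; have [sh re] := ri.
have [L [Lr Lc Lcl]] := closed_list (cst A) sh.
have [x [Hx Nx dx]] := re None L.
exists x; split=> // a phi a2 Hphi Hsat.
have [K0 HK] := Sigma2_transfer ri sh (fun d => re (Some d)) a2 Hphi Hsat.
pose K := (size L).+1 + K0.
have [y [Hy Ny dy]] := re (Some K) L.
exists y; split; first by move=> H; have := proj1 (dy K.+1) (proj2 (H _) I); rewrite ltnn.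
have pm : part_map (@prec k A) (@prec k A) rA rA (deg_upto K (@prec k A) (@prec k A))
    (List.map (fun z => (z, z)) L).
  split.
  - by apply/In_diag.
  - by move=> ? ? ? ? /In_diag [<- _] /In_diag [<- _].
  - by move=> ? ? ? ? /In_diag [<- _] /In_diag [<- _].
  - by move=> ? ? /In_diag [<- _]; split.
  - by move=> u v z /In_diag [_ Hu] zu; exists z; apply/In_diag; split=> //; apply: Lcl zu.
  - by move=> u v z /In_diag [<- Hu] zu; exists z; apply/In_diag; split=> //; apply: Lcl zu.
have pm' : part_map (@prec k A) (@prec k A) rA rA (deg_upto K (@prec k A) (@prec k A))
    ((x, y) :: List.map (fun z => (z, z)) L).
  apply: (pm_add_lev1 sh sh) => //.
  - by split=> m => [_|m'K _]; [apply/dx | apply/dy].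
  - by case=> z /In_diag [].
  - by case=> z /In_diag [->].
apply: (HK _ _ _ pm').
- by move=> i; rewrite !(tnth_nth x) /= ord1 /=; left.
- move=> i; right; apply/In_diag; split=> //; apply: Lc.
  by rewrite -[tval (cst A)]map_tnth_enum; apply/List.in_map_iff; exists i; split=> //;
    apply/In_mem; rewrite mem_enum.
- by rewrite /= /K; have -> : size (List.map (fun z => (z, z)) L) = size L
    by elim: (L) => //= ? ? ->.
Qed.

(** * Concrete trees *)

Lemma cleft_pair a b : cleft (cpair a b) = a.
Proof. by rewrite /cleft /cpair Cantor.cancel_of_to. Qed.

Lemma cright_pair a b : cright (cpair a b) = b.
Proof. by rewrite /cright /cpair Cantor.cancel_of_to. Qed.

Lemma cpair_surj x : cpair (cleft x) (cright x) = x.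
Proof. by rewrite /cpair /cleft /cright -surjective_pairing Cantor.cancel_to_of. Qed.

Lemma cpair_inj a b c d : cpair a b = cpair c d -> a = c /\ b = d.
Proof. by move=> E; rewrite -(cleft_pair a b) -{2}(cright_pair a b) E cleft_pair cright_pair. Qed.

Lemma cpair_ge a b : a + b <= cpair a b.
Proof. by have := Cantor.to_nat_non_decreasing a b; rewrite /cpair; lia. Qed.

(** The numbers that [node_of] decodes; [leafA d i j] is the child with number
    i + 1 of [nodeA (d + i.+1) j]. *)
Definition nodeA k j := (cpair 0 (cpair k j)).+1.
Definition nodeB j := (cpair 1 j).+1.
Definition leafA d i j := (cpair 2 (cpair (cpair d i) j)).+1.
Definition leafB j i := (cpair j.+3 i).+1.

Variant node_spec : nat -> Prop :=
| SpecRoot : node_spec 0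
| SpecA k j : node_spec (nodeA k j)
| SpecB j : node_spec (nodeB j)
| SpecLeafA d i j : node_spec (leafA d i j)
| SpecLeafB j i : node_spec (leafB j i).

Lemma nodeP x : node_spec x.
Proof.
case: x => [|y]; first exact: SpecRoot.
rewrite -(cpair_surj y); move: (cleft y) (cright y) => a b.
case: a => [|[|[|j]]].
- by rewrite -(cpair_surj b); apply: SpecA.
- exact: SpecB.
- by rewrite -(cpair_surj b) -(cpair_surj (cleft b)); apply: SpecLeafA.
- exact: SpecLeafB.
Qed.

(** For [Q = predT] this is the canonical tree.  For other Q with [Q 0], the
    nodes [nodeB j] with [Q j] false lose their children to [nodeB 0]: all these
    trees have the same universe, and the identity is a partial map between two
    of them wherever they agree. *)
Definition parent (Q : nat -> bool) (x : nat) : nat :=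
  if x is y.+1 then
    match cleft y with
    | 0 | 1 => 0
    | 2 => nodeA (cleft (cleft (cright y)) + (cright (cleft (cright y))).+1) (cright (cright y))
    | j.+3 => nodeB (if Q j then j else 0)
    end
  else 0.

Definition tree_rel Q (x y : nat) : Prop := y <> 0 /\ (x = 0 \/ x = parent Q y).

Section Concrete.
Variable Q : nat -> bool.
Local Notation R := (tree_rel Q).

Lemma parent0 : parent Q 0 = 0. Proof. by []. Qed.
Lemma parentA k j : parent Q (nodeA k j) = 0.
Proof. by rewrite /parent /nodeA cleft_pair. Qed.
Lemma parentB j : parent Q (nodeB j) = 0.
Proof. by rewrite /parent /nodeB cleft_pair. Qed.
Lemma parent_leafA d i j : parent Q (leafA d i j) = nodeA (d + i.+1) j.
Proof. by rewrite /parent /leafA !(cleft_pair, cright_pair). Qed.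
Lemma parent_leafB j i : parent Q (leafB j i) = nodeB (if Q j then j else 0).
Proof. by rewrite /parent /leafB !(cleft_pair, cright_pair). Qed.
Definition parentE := (parent0, parentA, parentB, parent_leafA, parent_leafB).

Lemma nodeA_inj k j k' j' : nodeA k j = nodeA k' j' -> k = k' /\ j = j'.
Proof. by case=> /cpair_inj [_ /cpair_inj]. Qed.
Lemma nodeB_inj : injective nodeB.
Proof. by move=> j j' [] /cpair_inj []. Qed.
Lemma nodeAB k j j' : nodeA k j <> nodeB j'.
Proof. by case=> /cpair_inj []. Qed.

Lemma parent_parent x : parent Q (parent Q x) = 0.
Proof. by case: (nodeP x) => *; rewrite !parentE. Qed.

Lemma parent_neq x : x <> 0 -> parent Q x <> x.
Proof. by case: (nodeP x) => * ; rewrite !parentE //; case=> /cpair_inj []. Qed.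

Lemma tree_shallow : shallow R 0.
Proof.
split.
- by move=> x [x0 [//|E]]; apply: (parent_neq x0).
- move=> x y z [y0 xy] [z0 [//|yz]]; split=> //; left.
  by case: xy => // ->; rewrite yz parent_parent.
- move=> x y z [x0 yx] [_ zx].
  have [->|z0] := eqVneq z 0; have [->|y0] := eqVneq y 0.
  + by constructor 2.
  + by constructor 3; split; [apply/eqP|left].
  + by constructor 1; split; [apply/eqP|left].
  case: yx y0 => [-> //|->] _; case: zx z0 => [-> //|-> _]; by constructor 2.
- move=> x y z w [y0 _] [z0 [//|yz]] [w0 [//|zw]].
  by apply: y0; rewrite yz zw parent_parent.
- by move=> x; have [->|/eqP x0] := eqVneq x 0; [left | right; split=> //; left].
Qed.

Lemma tree_lev1 x : lev1 R 0 x <-> x <> 0 /\ parent Q x = 0.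
Proof.
split=> [[[x0 _] H]|[x0 px]]; split=> //.
- by apply: H; split=> //; right.
- by split=> //; left.
- by move=> z [_ [->|->]].
Qed.

Lemma lev1A k j : lev1 R 0 (nodeA k j).
Proof. by apply/tree_lev1; rewrite parentE. Qed.
Lemma lev1B j : lev1 R 0 (nodeB j).
Proof. by apply/tree_lev1; rewrite parentE. Qed.

Lemma tree_above_map (g : nat -> nat) x m :
  (forall i i', g i = g i' -> i = i') -> (forall i, i < m -> R x (g i)) -> above R x m.
Proof.
move=> gi gR; exists (List.map g (List.seq 0 m)); split.
- by apply: FinFun.Injective_map_NoDup => //; apply: List.seq_NoDup.
- exact: size_map_seq.
- move=> y /List.in_map_iff [i [<- /List.in_seq Hi]]; apply: gR; lia.
Qed.

Lemma tree_deg_root : deg_is R 0 None.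
Proof.
move=> m; split=> // _; apply: (@tree_above_map S); first by move=> ? ? [].
by move=> i _; split=> //; left.
Qed.

Lemma tree_degA k j : deg_is R (nodeA k j) (Some k).
Proof.
move=> m; split=> [|mk].
  case=> w [ndw <- Hw].
  rewrite -[leqRHS](size_map_seq (fun i => leafA (k - i.+1) i j)).
  apply: NoDup_incl_size => // y /Hw [y0 [//|]].
  case: (nodeP y) y0 => [|k' j'|j'|d i j'|j' i] _; rewrite ?parentE //.
    case/nodeA_inj => E <-; apply/List.in_map_iff; exists i; split.
      by congr leafA; lia.
    by apply/List.in_seq; lia.
  by move/nodeAB.
apply: (@tree_above_map (fun i => leafA (k - i.+1) i j)).
  by move=> i i' [] /cpair_inj [_ /cpair_inj [/cpair_inj []]].
move=> i im; split=> //; right; rewrite parentE; congr nodeA; lia.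
Qed.

Lemma tree_degB j : Q j -> deg_is R (nodeB j) None.
Proof.
move=> Qj m; split=> // _; apply: (@tree_above_map (leafB j)).
  by move=> i i' [] /cpair_inj [].
by move=> i _; split=> //; right; rewrite parentE Qj.
Qed.

Lemma tree_degB0 j : Q 0 -> ~~ Q j -> ~ above R (nodeB j) 1.
Proof.
move=> Q0 Qj [[|y w] [_ //= _ /(_ y (or_introl erefl)) [y0 [//|]]]].
case: (nodeP y) y0 => [|k' j'|j'|d i j'|j' i] _; rewrite ?parentE //.
  by move/esym/nodeAB.
move/nodeB_inj => E; move: Qj; rewrite E.
by case: ifP => [->|_]; rewrite ?Q0.
Qed.

Lemma tree_realizesA d : realizes R 0 (Some d).
Proof.
move=> L; have [N HN] := list_bound L.
exists (nodeA d N); split; [exact: lev1A | | exact: tree_degA].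
move/HN; rewrite /nodeA; have := cpair_ge 0 (cpair d N); have := cpair_ge d N; lia.
Qed.

End Concrete.

Lemma tree_realizesB : realizes (tree_rel predT) 0 None.
Proof.
move=> L; have [N HN] := list_bound L.
exists (nodeB N); split; [exact: lev1B | | exact: tree_degB].
move/HN; rewrite /nodeB; have := cpair_ge 1 N; lia.
Qed.

Lemma tree_rich : rich (tree_rel predT) 0.
Proof.
split; first exact: tree_shallow.
by case=> [d|]; [apply: tree_realizesA | apply: tree_realizesB].
Qed.

Definition tree_struct (Q : nat -> bool) : structure 0 :=
  @Structure 0 nat (tree_rel Q) [tuple of [::]] (inhabits 0).

Lemma node_of_root : node_of 0 = NRoot. Proof. by []. Qed.
Lemma node_ofA k j : node_of (nodeA k j) = NA k j.
Proof. by rewrite /nodeA /= cleft_pair !(cleft_pair, cright_pair). Qed.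
Lemma node_ofB j : node_of (nodeB j) = NB j.
Proof. by rewrite /nodeB /= cleft_pair !(cleft_pair, cright_pair). Qed.
Lemma node_of_leafA d i j : node_of (leafA d i j) = NAchild (d + i.+1) j i.+1.
Proof. by rewrite /leafA /= cleft_pair !(cleft_pair, cright_pair). Qed.
Lemma node_of_leafB j i : node_of (leafB j i) = NBchild j i.
Proof. by rewrite /leafB /= cleft_pair !(cleft_pair, cright_pair). Qed.

Lemma canonical_prec x y :
  node_prec (node_of x) (node_of y) <-> tree_rel predT x y.
Proof.
rewrite /tree_rel.
have E := (node_of_root, node_ofA, node_ofB, node_of_leafA, node_of_leafB, parentE).
case: (nodeP y) => *; rewrite !E; case: (nodeP x) => *; rewrite ?E /=; split=> //.
all: try by case=> [? [|]].
all: try by (move=> *; split=> //; left).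
all: try by case=> _ [//|[/cpair_inj []]].
- by case=> -> ->; split=> //; right.
- by case=> _ [//|/nodeA_inj].
- by move=> ->; split=> //; right.
Qed.

Lemma canonical_iso : iso canonical_A2 (tree_struct predT).
Proof.
exists id; split; [by exists id | | exact: tuple0].
by move=> x y; apply: canonical_prec.
Qed.

(** Q keeps infinite the degrees of the nodes [nodeB j] for j up to a bound for
    the elements of a closed list containing p.  The identity on this list preserves
    degrees, while an isomorphism would inject infinitely many nodes of infinite
    degree into finitely many. *)
Lemma tree_companion n (p : n.-tuple nat) :
  exists Q l, [/\ ~ iso (tree_struct predT) (tree_struct Q),
    part_map (tree_rel predT) (tree_rel Q) 0 0
      (same_deg (tree_rel predT) (tree_rel Q)) l &
    paired l p p].
Proof.
have [L [L0 Lp Lcl]] := closed_list p (tree_shallow predT).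
have [N HN] := list_bound L.
pose Q j := j < N.+1.
have small j : List.In (nodeB j) L -> Q j.
  by move/HN; rewrite /Q /nodeB; have := cpair_ge 1 j; lia.
have par_eq x : List.In x L -> parent Q x = parent predT x.
  case: (nodeP x) => // [k j|j|d i j|j i] HL; rewrite !parentE //.
  have : List.In (nodeB j) L.
    by apply: Lcl HL _; split=> //; right; rewrite parentE.
  by move/small => ->.
exists Q, (List.map (fun z => (z, z)) L); split.
- case=> f [[g fK gK] Hf _].
  have f0 : f 0 = 0.
    apply: NNPP => f0; have [_ H] := Hf 0 (g 0).
    have fg0 : f (g 0) = 0 by apply: gK.
    have {}H : tree_rel predT (g 0) 0.
      by apply/Hf; rewrite fg0; split=> //; left.
    by case: H.
  have fB j : exists2 j', Q j' & f (nodeB j) = nodeB j'.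
    have lv : lev1 (tree_rel Q) 0 (f (nodeB j)).
      split; first by rewrite -f0; apply/(Hf 0 _); case: (lev1B predT j).
      move=> z; rewrite -(gK z) => /(Hf (g z) _) H; rewrite -f0; congr f.
      by case: (lev1B predT j) => _; apply.
    have ab m : above (tree_rel Q) (f (nodeB j)) m.
      have [w [ndw sw Hw]] := proj2 (tree_degB (Q := predT) (j := j) isT m) I.
      exists (List.map f w); split.
      - apply: FinFun.Injective_map_NoDup => //; exact: can_inj fK.
      - by rewrite -sw; apply: List.length_map.
      - by move=> y /List.in_map_iff [z [<- /Hw /(Hf _ _)]].
    have [_ p0] := proj1 (tree_lev1 _ _) lv.
    case: (nodeP (f (nodeB j))) lv ab p0 => [|k j'|j'|d i j'|j' i] lv ab.
    - by case: lv => -[].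
    - by move=> _; have := proj1 (tree_degA Q k j' k.+1) (ab _); rewrite ltnn.
    - move=> _; exists j' => //; apply/negPn/negP => Qj.
      exact: (tree_degB0 (Q := Q) isT Qj (ab 1)).
    - by rewrite parentE.
    - by rewrite parentE.
  have [|j [_ []]] := @pigeonhole _ (fun j => f (nodeB j) : nat) (List.map nodeB (List.seq 0 N.+1)).
    by move=> i j _ _ /(can_inj fK) /nodeB_inj.
  have [j' Qj ->] := fB j; apply/List.in_map_iff; exists j'; split=> //.
  by apply/List.in_seq; rewrite /Q in Qj; lia.
- split.
  + by apply/In_diag.
  + by move=> ? ? ? ? /In_diag [<- _] /In_diag [<- _].
  + by move=> ? ? ? y /In_diag [<- _] /In_diag [<- Hy]; rewrite /tree_rel par_eq.
  + move=> x y /In_diag [<- Hx].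
    case: (nodeP x) Hx => [|k j|j|d i j|j i] Hx.
    * by apply: (@deg_is_same _ _ _ _ _ _ None); apply: tree_deg_root.
    * by apply: (@deg_is_same _ _ _ _ _ _ (Some k)); apply: tree_degA.
    * by apply: (@deg_is_same _ _ _ _ _ _ None); apply: tree_degB => //; apply: small.
    * by apply: (@deg_is_same _ _ _ _ _ _ (Some 0));
        apply: (lev2_leaf (p := nodeA (d + i.+1) j) (tree_shallow _) (lev1A _ _ _));
        split=> //; right; rewrite parentE.
    * apply: (@deg_is_same _ _ _ _ _ _ (Some 0)).
        apply: (lev2_leaf (p := nodeB j) (tree_shallow predT) (lev1B predT j)).
        by split=> //; right; rewrite parentE.
      apply: (lev2_leaf (p := nodeB (if Q j then j else 0)) (tree_shallow Q) (lev1B Q _)).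
      by split=> //; right; rewrite parentE.
  + move=> u v z /In_diag [_ Hu] zu; exists z; apply/In_diag; split=> //; apply: Lcl zu => //.
  + move=> u v z /In_diag [<- Hu] [u0 zu]; exists z; apply/In_diag; split=> //.
    by apply: Lcl (Hu) _; split=> //; rewrite -par_eq.
- move=> i; apply/In_diag; split=> //; apply: Lp.
  by apply/In_mem; apply: mem_tnth.
Qed.

(** * Computable functions *)

(** The equivalence contains both totality and determinism of the program. *)
Definition computes (c : code) (f : nat -> nat) : Prop := forall x y, eval c x y <-> y = f x.
Definition computable (f : nat -> nat) : Prop := exists c, computes c f.

Lemma computable_ext f g : (forall x, f x = g x) -> computable f -> computable g.
Proof. by move=> fg [c Hc]; exists c => x y; rewrite -fg. Qed.

Lemma computable_left f : computable f -> computable (fun x => cleft (f x)).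
Proof.
move=> [c Hc]; exists (KComp KLeft c) => x y /=; split; first by case=> z [/Hc ->].
by move=> ->; exists (f x); split=> //; apply/Hc.
Qed.

Lemma computable_right f : computable f -> computable (fun x => cright (f x)).
Proof.
move=> [c Hc]; exists (KComp KRight c) => x y /=; split; first by case=> z [/Hc ->].
by move=> ->; exists (f x); split=> //; apply/Hc.
Qed.

Lemma computable_succ f : computable f -> computable (fun x => (f x).+1).
Proof.
move=> [c Hc]; exists (KComp KSucc c) => x y /=; split; first by case=> z [/Hc ->].
by move=> ->; exists (f x); split=> //; apply/Hc.
Qed.

Lemma computable_pair f g : computable f -> computable g ->
  computable (fun x => cpair (f x) (g x)).
Proof.
move=> [c Hc] [d Hd]; exists (KPair c d) => x y /=; split.
  by case=> u [v [/Hc -> /Hd ->]].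
by move=> ->; exists (f x), (g x); split=> //; [apply/Hc | apply/Hd].
Qed.

Lemma computable_comp f g : computable f -> computable g -> computable (fun x => f (g x)).
Proof.
move=> [c Hc] [d Hd]; exists (KComp c d) => x y /=; split; first by case=> z [/Hd -> /Hc].
by move=> ->; exists (g x); split; [apply/Hd | apply/Hc].
Qed.

(** Programs for constants; their Goedel numbers are computable in the constant,
    which gives s-m-n. *)
Fixpoint kconst (n : nat) : code := if n is m.+1 then KComp KSucc (kconst m) else KZero.

Lemma kconstP n : computes (kconst n) (fun=> n).
Proof.
elim: n => [|n IH] x y //=; split; first by case=> z [/IH ->].
by move=> ->; exists n; split=> //; apply/IH.
Qed.

Lemma computable_const n : computable (fun=> n).
Proof. by exists (kconst n); apply: kconstP. Qed.

Definition kid : code := KPair KLeft KRight.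

Lemma kidP : computes kid id.
Proof.
move=> x y /=; split; first by case=> u [v [-> -> ->]]; rewrite cpair_surj.
by move=> ->; exists (cleft x), (cright x); rewrite cpair_surj.
Qed.

Lemma computable_id : computable (fun x => x).
Proof. by exists kid; apply: kidP. Qed.

Lemma computable_iteri n (g : nat -> nat -> nat -> nat) f :
  computable n -> computable f ->
  computable (fun u => g (cleft u) (cleft (cright u)) (cright (cright u))) ->
  computable (fun x => iteri (n x) (g x) (f x)).
Proof.
move=> [cn Hn] [cf Hf] [cg Hg].
exists (KComp (KPrec cf cg) (KPair kid cn)) => x y.
have rec a i z :
  ((fix rec (i z : nat) {struct i} : Prop :=
         match i with
         | 0 => eval cf a z
         | j.+1 =>
             exists w, rec j w /\ eval cg (cpair a (cpair j w)) z
         end) i z) <-> z = iteri i (g a) (f a).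
  elim: i z => [|i IH] z; first exact: Hf.
  split; first by case=> w [/IH -> /Hg]; rewrite !(cleft_pair, cright_pair).
  move=> ->; exists (iteri i (g a) (f a)); split; first exact/IH.
  by apply/Hg; rewrite !(cleft_pair, cright_pair).
split.
  case=> z [[u [v [/kidP -> /Hn -> ->]]]] /=; rewrite cleft_pair cright_pair.
  by move/rec.
move=> ->; exists (cpair x (n x)); split.
  by exists x, (n x); split=> //; [apply/kidP | apply/Hn].
by rewrite /= cleft_pair cright_pair; apply/rec.
Qed.

Lemma computable_pred f : computable f -> computable (fun x => (f x).-1).
Proof.
move=> cf; apply: (@computable_ext (fun x => iteri (f x) (fun j _ => j) 0)).
  by move=> x; case: (f x).
apply: computable_iteri => //; first exact: computable_const.
exact/computable_left/computable_right/computable_id.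
Qed.

Lemma computable_add f g : computable f -> computable g -> computable (fun x => f x + g x).
Proof.
move=> cf cg; apply: (@computable_ext (fun x => iteri (g x) (fun _ w => w.+1) (f x))).
  by move=> x; elim: (g x) => [|n /= ->]; rewrite ?addn0 ?addnS.
apply: computable_iteri => //.
exact/computable_succ/computable_right/computable_right/computable_id.
Qed.

Lemma computable_sub f g : computable f -> computable g -> computable (fun x => f x - g x).
Proof.
move=> cf cg; apply: (@computable_ext (fun x => iteri (g x) (fun _ w => w.-1) (f x))).
  by move=> x; elim: (g x) => [|n /= ->]; rewrite ?subn0 ?subnS.
apply: computable_iteri => //.
exact/computable_pred/computable_right/computable_right/computable_id.
Qed.

Lemma computable_if_eq f g h k : computable f -> computable g -> computable h -> computable k ->
  computable (fun x => if f x == g x then h x else k x).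
Proof.
move=> cf cg ch ck.
apply: (@computable_ext (fun x => iteri ((f x - g x) + (g x - f x)) (fun _ _ => k x) (h x))).
  move=> x; case: eqP => [->|N]; first by rewrite !subnn.
  have -> : (f x - g x) + (g x - f x) = ((f x - g x) + (g x - f x)).-1.+1 by lia.
  by [].
apply: (@computable_iteri _ (fun x _ _ => k x)) => //.
  by apply: computable_add; apply: computable_sub.
exact: (computable_comp ck (computable_left computable_id)).
Qed.

Lemma computable_if_le f g h k : computable f -> computable g -> computable h -> computable k ->
  computable (fun x => if f x <= g x then h x else k x).
Proof.
move=> cf cg ch ck.
apply: (@computable_ext (fun x => if f x - g x == 0 then h x else k x)) => //.
apply: computable_if_eq => //; [exact: computable_sub | exact: computable_const].
Qed.

Lemma computable_min f g : computable f -> computable g -> computable (fun x => minn (f x) (g x)).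
Proof.
move=> cf cg; apply: (@computable_ext (fun x => if f x <= g x then f x else g x)).
  by move=> x; case: leqP => // ?; lia.
exact: computable_if_le.
Qed.

Lemma computable_iter n f g h :
  computable n -> computable f -> computable g -> (forall x, h x = iter (n x) f (g x)) ->
  computable h.
Proof.
move=> cn cf cg E; apply: (@computable_ext (fun x => iteri (n x) (fun _ => f) (g x))).
  by move=> x; rewrite E; elim: (n x) => //= m ->.
apply: computable_iteri => //.
exact/(computable_comp cf)/computable_right/computable_right/computable_id.
Qed.

Lemma goedel_inj : injective goedel.
Proof.
elim=> [||||f IHf g IHg|f IHf g IHg|f IHf g IHg|f IHf] [||||f' g'|f' g'|f' g'|f'] //=;
  case/cpair_inj => // _; rewrite -/goedel.
- by case/cpair_inj => /IHf -> /IHg ->.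
- by case/cpair_inj => /IHf -> /IHg ->.
- by case/cpair_inj => /IHf -> /IHg ->.
- by move/IHf ->.
Qed.

Lemma Phi_goedel c x y : Phi (goedel c) x y <-> eval c x y.
Proof. by split=> [[c' [/goedel_inj ->]]|H] //; exists c. Qed.

Lemma eval_fun c x y y' : eval c x y -> eval c x y' -> y = y'.
Proof.
elim: c x y y' => [||||f IHf g IHg|f IHf g IHg|f IHf g IHg|f IHf] x y y' /=.
- by move=> -> ->.
- by move=> -> ->.
- by move=> -> ->.
- by move=> -> ->.
- by case=> u [v [Hu Hv ->]] [u' [v' [/(IHf _ _ _ Hu) <- /(IHg _ _ _ Hv) <- ->]]].
- by case=> u [Hu Hv] [u' [/(IHg _ _ _ Hu) <-]]; apply: IHf.
- elim: (cright x) y y' => [|i IH] y y'; first exact: IHf.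
  by case=> w [Hw Hy] [w' [/(IH _ _ Hw) <-]]; apply: IHg.
- move=> [H0 Hl] [H0' Hl']; case: (ltngtP y y') => // ll.
    by have [v /(IHf _ _ _ H0)] := Hl' _ ll.
  by have [v /(IHf _ _ _ H0')] := Hl _ ll.
Qed.

Lemma Phi_fun e x y y' : Phi e x y -> Phi e x y' -> y = y'.
Proof. by case=> c [<- H] /Phi_goedel; apply: eval_fun H. Qed.

Lemma computable_goedel_kconst : computable (fun p => goedel (kconst p)).
Proof.
apply: (@computable_ext (fun p =>
  iteri p (fun _ w => cpair 5 (cpair (cpair 1 0) w)) (cpair 0 0))).
  by elim=> //= p ->.
apply: (@computable_iteri id (fun x _ w => cpair 5 (cpair (cpair 1 0) w)) (fun=> cpair 0 0)).
- exact: computable_id.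
- exact: computable_const.
- apply: computable_pair; first exact: computable_const.
  apply: computable_pair; first exact: computable_const.
  exact/computable_right/computable_right/computable_id.
Qed.

(** The parameter p is hard-wired into a program that searches for a preimage
    of its input under [f p]; this index is computable in p. *)
Lemma ce_ranges (f : nat -> nat -> nat) :
  computable (fun u => f (cleft u) (cright u)) ->
  exists E : nat -> nat, computable E /\
    forall p x, W (E p) x <-> exists z, x = f p z.
Proof.
move=> cf.
have [c Hc] : computable (fun u =>
    if cleft (cright u) == f (cleft u) (cright (cright u)) then 0 else 1).
  apply: computable_if_eq.
  - exact/computable_left/computable_right/computable_id.
  - apply: (@computable_ext (fun u => (fun u => f (cleft u) (cright u))
      (cpair (cleft u) (cright (cright u))))).
      by move=> u; rewrite cleft_pair cright_pair.
    apply: (computable_comp cf); apply: computable_pair.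
      exact: (computable_left computable_id).
    exact: (computable_right (computable_right computable_id)).
  - exact: computable_const.
  - exact: computable_const.
pose K p := KMu (KComp c (KPair (kconst p) kid)).
exists (fun p => goedel (K p)); split.
  apply: (@computable_ext (fun p => cpair 7 (cpair 5 (cpair (goedel c)
    (cpair 4 (cpair (goedel (kconst p)) (goedel kid))))))) => //.
  do ! [exact: computable_const | exact: computable_goedel_kconst | apply: computable_pair].
move=> p x.
have Hin z v : eval (KComp c (KPair (kconst p) kid)) (cpair x z) v <->
    v = if x == f p z then 0 else 1.
  split.
    case=> u [[u1 [u2 [/kconstP -> /kidP -> ->]]] /Hc].
    by rewrite !(cleft_pair, cright_pair).
  move=> ->; exists (cpair p (cpair x z)); split.
    by exists p, (cpair x z); split=> //; [apply/kconstP | apply/kidP].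
  by apply/Hc; rewrite !(cleft_pair, cright_pair).
split.
  case=> y /Phi_goedel [/Hin H _]; exists y; move: H; case: eqP => //.
case=> z xz; have ex : exists z, x == f p z by exists z; rewrite xz.
case: (ex_minnP ex) => y /eqP Hy ymin; exists y; apply/Phi_goedel; split.
  by apply/Hin; rewrite -Hy eqxx.
move=> z' z'y; exists 0; apply/Hin; case: eqP => // /eqP /ymin; lia.
Qed.

(** * Notations and indices *)

Definition fin_notation (n : nat) : nat := iter n (expn 2) 1.

Lemma fin_notation_gt0 n : 0 < fin_notation n.
Proof. by case: n => //= n; rewrite expn_gt0. Qed.

Lemma fin_notationP n : O_notation (fin_notation n) (bfin n).
Proof. by elim: n => [|n IH]; [apply: notation_zero | apply: notation_succ]. Qed.

Lemma klt_fin_notation m n : m < n -> klt (fin_notation m) (fin_notation n).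
Proof.
elim: n => // n IH; rewrite ltnS leq_eqVlt => /orP[/eqP ->|/IH H].
  exact: klt_succ (fin_notation_gt0 n).
exact: klt_trans H (klt_succ (fin_notation_gt0 n)).
Qed.

Lemma fin_notation_neq1 n : fin_notation n.+1 <> 1.
Proof.
move=> H; have := ltn_expl (fin_notation n) (isT : 1 < 2).
by rewrite -[2 ^ _]/(fin_notation n.+1) H; have := fin_notation_gt0 n; lia.
Qed.

Lemma O_notation0 al : ~ O_notation 0 al.
Proof.
move E: 0 => a H; case: H E => // [b be _ H|e f be _ _ _ H].
  by have := expn_gt0 2 b; rewrite -H.
by have := expn_gt0 5 e; lia.
Qed.

Lemma pow2_lim a e : 2 ^ a <> 3 * 5 ^ e.
Proof.
case: a => [|a]; first by have := expn_gt0 5 e; rewrite expn0; lia.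
by move/(congr1 odd); rewrite oddM !oddX /= ?orbT.
Qed.

Lemma O_notation_neq0 a al : O_notation a al -> 0 < a.
Proof. by case: a => // /O_notation0. Qed.

(** The transitivity of [klt] hides the chain of predecessors; recording the
    property hereditarily lets the induction on [klt] follow it. *)
Inductive hered_notation (a : nat) (al : bord) : Prop := HeredNotation of
  O_notation a al &
  (forall b, klt b a -> exists be, hered_notation b be /\ olt be al).

Lemma O_notation_hered a al : O_notation a al -> hered_notation a al.
Proof.
elim=> {a al}[|a al Ha IH|e f al Hf kf Hal IH].
- split; first exact: notation_zero.
  move=> b; move E: 1 => u H; elim: H E => {b u}[a a0|e i a|a b c _ _ _ IH] E.
  + by have := ltn_expl a (isT : 1 < 2); lia.
  + by have := expn_gt0 5 e; lia.
  + have [be [[_ H1] H2]] := IH E.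
    by have := olt_le H2; case: be {H1} H2.
- split; first exact: notation_succ.
  move=> b; move E: (2 ^ a) => u H; elim: H E => {b u}[b b0|e i b _|b c d bc _ _ IHd] E.
  + have <- : a = b by apply/eqP; rewrite -(@eqn_exp2l 2) // E.
    by exists al; split=> //; apply: (ole_refl al).
  + by case: (pow2_lim E).
  + have [be [[_ H1] H2]] := IHd E; have [be' [H3 H4]] := H1 _ bc.
    by exists be'; split=> //; apply: olt_trans H2.
- split; first exact: notation_lim.
  move=> b; move E: (3 * 5 ^ e) => u H; elim: H E => {b u}[b b0|e' i b Hb|b c d bc _ _ IHd] E.
  + by case: (pow2_lim (esym E)).
  + have ee : e = e'.
      by apply/eqP; rewrite -(@eqn_exp2l 5) //; apply/eqP; lia.
    rewrite -ee in Hb; rewrite (Phi_fun Hb (Hf i)).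
    have [_ H1] := IH i.+1; have [be [H2 H3]] := H1 _ (kf i).
    by exists be; split=> //; exists i.+1.
  + have [be [[_ H1] H2]] := IHd E; have [be' [H3 H4]] := H1 _ bc.
    by exists be'; split=> //; apply: olt_trans H2.
Qed.

Lemma klt_olt b a al : O_notation a al -> klt b a ->
  exists be, O_notation b be /\ olt be al.
Proof.
move=> /O_notation_hered [_ H] /H [be [[H1 _] H2]]; by exists be.
Qed.

Lemma O_notation1 al : O_notation 1 al -> ole al bzero.
Proof.
move E: 1 => a H; case: H E => // [b be Hb E|e f be _ _ _ E].
  by have := O_notation_neq0 Hb; have := ltn_expl b (isT : 1 < 2); lia.
by have := expn_gt0 5 e; lia.
Qed.

Lemma O_notation_pos a al : a <> 1 -> O_notation a al -> olt bzero al.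
Proof.
move=> a1 H; case: H a1 => // e f be Hf kf Hbe _.
have Hlim := notation_lim Hf kf Hbe.
have [ga [_ H]] := klt_olt Hlim (klt_lim (Hf 0)).
by apply: ole_lt_trans H.
Qed.

Scheme Sigma_index_mut := Minimality for Sigma_index Sort Prop
  with Pi_index_mut := Minimality for Pi_index Sort Prop.
Combined Scheme index_mut from Sigma_index_mut, Pi_index_mut.

(** The notations recorded in an index decrease along [klt], so the ordinals
    that they denote decrease. *)
Lemma index_is_class k n :
  (forall a i (phi : form k n), Sigma_index a i phi ->
    forall al, O_notation a al -> is_Sigma al phi) /\
  (forall a i (phi : form k n), Pi_index a i phi ->
    forall al, O_notation a al -> is_Pi al phi).
Proof.
move: n; apply: (@index_mut k
  (fun n a _ phi => forall al, O_notation a al -> is_Sigma al phi)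
  (fun n a _ phi => forall al, O_notation a al -> is_Pi al phi)) => /= [n q al|n a e b psi a1 kl _ IH al Ha|n q al|n a e b psi a1 kl _ IH al Ha].
- exact: O_notation1.
- split=> [|x Hx]; first exact: O_notation_pos Ha.
  by have [be [Hb lt]] := klt_olt Ha (kl x Hx); exists be; split=> //; apply: IH.
- exact: O_notation1.
- split=> [|x Hx]; first exact: O_notation_pos Ha.
  by have [be [Hb lt]] := klt_olt Ha (kl x Hx); exists be; split=> //; apply: IH.
Qed.

Lemma is_Sigma_oeq k n a b (phi : form k n) : oeq a b -> is_Sigma a phi -> is_Sigma b phi.
Proof.
move=> [ab ba]; case: phi => //= [q|J F [a0 H]]; first exact: ole_trans.
split=> [|i /H]; first exact: (ole_trans a0 ab).
by case: (F i) => // m psi [c [ca Hc]]; exists c; split=> //; apply: (ole_trans ca ab).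
Qed.

Lemma is_Pi_oeq k n a b (phi : form k n) : oeq a b -> is_Pi a phi -> is_Pi b phi.
Proof.
move=> [ab ba]; case: phi => //= [q|J F [a0 H]]; first exact: ole_trans.
split=> [|i /H]; first exact: (ole_trans a0 ab).
by case: (F i) => // m psi [c [ca Hc]]; exists c; split=> //; apply: (ole_trans ca ab).
Qed.

Lemma cSigma_is_Sigma k n al i (phi : form k n) : cSigma_with_index al i phi -> is_Sigma al phi.
Proof.
case=> a [be [Ha oe Hi]]; apply: is_Sigma_oeq oe _.
exact: (proj1 (index_is_class _ _)) Hi _ Ha.
Qed.

Lemma cPi_is_Pi k n al i (phi : form k n) : cPi_with_index al i phi -> is_Pi al phi.
Proof.
case=> a [be [Ha oe Hi]]; apply: is_Pi_oeq oe _.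
exact: (proj2 (index_is_class _ _)) Hi _ Ha.
Qed.

Lemma class_c_in k n G (phi : form k n) : class_c G phi -> class_in G phi.
Proof.
case: G => al /=.
- by case=> i; apply: cSigma_is_Sigma.
- by case=> i; apply: cPi_is_Pi.
- case=> psi [chi [[i Hi] [j Hj] ->]]; exists psi, chi; split=> //.
    exact: cSigma_is_Sigma Hi.
  exact: cPi_is_Pi Hj.
Qed.

Lemma tcode_inj k n : injective (@tcode k n).
Proof. by case=> [i|i] [j|j] /= /cpair_inj [] // _ /val_inj ->. Qed.

Lemma qcode_inj k n : injective (@qcode k n).
Proof.
elim=> [|u v|u v|q IH|q IH r IH'|q IH r IH'] [|u' v'|u' v'|q'|q' r'|q' r'] /=; case/cpair_inj => //.
- by move=> _ /cpair_inj [/tcode_inj -> /tcode_inj ->].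
- by move=> _ /cpair_inj [/tcode_inj -> /tcode_inj ->].
- by move=> _ /IH ->.
- by move=> _ /cpair_inj [/IH -> /IH' ->].
- by move=> _ /cpair_inj [/IH -> /IH' ->].
Qed.

Definition same_sat k n (phi phi' : form k n) :=
  forall (A : structure k) (t : n.-tuple A), sat phi t <-> sat phi' t.

(** An index contains the set W e and the indices of the subformulas; only the
    values [psi x] for x outside W e are left free, and satisfaction ignores
    them. *)
Lemma index_sat k n :
  (forall a i (phi : form k n), Sigma_index a i phi ->
    forall a' (phi' : form k n), Sigma_index a' i phi' -> same_sat phi phi') /\
  (forall a i (phi : form k n), Pi_index a i phi ->
    forall a' (phi' : form k n), Pi_index a' i phi' -> same_sat phi phi').
Proof.
move: n; apply: (@index_mut k
  (fun n _ i phi => forall a' (phi' : form k n), Sigma_index a' i phi' -> same_sat phi phi')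
  (fun n _ i phi => forall a' (phi' : form k n), Pi_index a' i phi' -> same_sat phi phi')) =>
  /= [n q a' phi'|n a e b psi a1 kl H IH a' phi'|n q a' phi'|n a e b psi a1 kl H IH a' phi'].
- move E: (cpair _ _) => i H; case: H E => [q' /cpair_inj [_ /cpair_inj [_ /qcode_inj ->]] //|].
  by move=> ? ? ? ? ? ? ? /cpair_inj [].
- move E: (cpair _ _) => i H'; case: H' E => [q' /cpair_inj [] //|].
  move=> a2 e2 b2 psi2 _ _ H2 /cpair_inj [_ /cpair_inj [_ /cpair_inj [_ ee]]] A t.
  by split=> [] [x [Wx [s Hs]]]; exists x; rewrite -?ee in H2 Wx *; split=> //; exists s;
    apply/(IH x Wx _ _ (H2 x Wx)).
- move E: (cpair _ _) => i H; case: H E => [q' /cpair_inj [_ /cpair_inj [_ /qcode_inj ->]] //|].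
  by move=> ? ? ? ? ? ? ? /cpair_inj [].
- move E: (cpair _ _) => i H'; case: H' E => [q' /cpair_inj [] //|].
  move=> a2 e2 b2 psi2 _ _ H2 /cpair_inj [_ /cpair_inj [_ /cpair_inj [_ ee]]] A t.
  split=> Ht x Wx s; have Wx' := Wx; rewrite ?ee -?ee in H2 Wx Wx'.
    by apply/(IH x Wx _ _ (H2 x Wx)); apply: Ht.
  by apply/(IH x Wx _ _ (H2 x Wx)); apply: Ht; rewrite -ee.
Qed.

(** * Predicates represented by an index *)

(** Tuples are read as sequences with a default value, so that the meaning of a
    formula can be described without dependent types. *)
Definition dflt (A : structure 0) : A := epsilon (carrier_inhabited A) (fun=> True).
Definition entry (A : structure 0) (s : seq A) (i : nat) : A := nth (dflt A) s i.
Arguments entry : simpl never.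

Definition spred := forall A : structure 0, seq A -> Prop.

(** A formula is handled through its code or index and its meaning in all
    structures.  A body under a block of quantifiers has type
    [form k (n + cleft x)], where [cleft x] equals the intended length of the
    block only propositionally; existential statements avoid the casts. *)
Definition repQ (n c : nat) (Q : spred) : Prop :=
  exists q : qf 0 n, qcode q = c /\ forall (A : structure 0) (t : n.-tuple A), qsat t q <-> Q A t.
Definition repS (n l i : nat) (Q : spred) : Prop :=
  exists phi : form 0 n, Sigma_index (fin_notation l) i phi /\
    forall (A : structure 0) (t : n.-tuple A), sat phi t <-> Q A t.
Definition repP (n l i : nat) (Q : spred) : Prop :=
  exists phi : form 0 n, Pi_index (fin_notation l) i phi /\
    forall (A : structure 0) (t : n.-tuple A), sat phi t <-> Q A t.

Lemma repQ_iff n c (Q Q' : spred) :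
  (forall (A : structure 0) (s : seq A), size s = n -> (Q A s <-> Q' A s)) -> repQ n c Q -> repQ n c Q'.
Proof.
move=> QQ [q [cq Hq]]; exists q; split=> // A t; rewrite Hq; apply: QQ; exact: size_tuple.
Qed.

Lemma repS_iff n l c (Q Q' : spred) :
  (forall (A : structure 0) (s : seq A), size s = n -> (Q A s <-> Q' A s)) -> repS n l c Q -> repS n l c Q'.
Proof.
move=> QQ [q [cq Hq]]; exists q; split=> // A t; rewrite Hq; apply: QQ; exact: size_tuple.
Qed.

Lemma repP_iff n l c (Q Q' : spred) :
  (forall (A : structure 0) (s : seq A), size s = n -> (Q A s <-> Q' A s)) -> repP n l c Q -> repP n l c Q'.
Proof.
move=> QQ [q [cq Hq]]; exists q; split=> // A t; rewrite Hq; apply: QQ; exact: size_tuple.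
Qed.

Definition c_true := cpair 0 0.
Definition c_lt i j := cpair 1 (cpair (cpair 0 i) (cpair 0 j)).
Definition c_eq i j := cpair 2 (cpair (cpair 0 i) (cpair 0 j)).
Definition c_not a := cpair 3 a.
Definition c_and a b := cpair 4 (cpair a b).
Definition c_or a b := cpair 5 (cpair a b).
Definition c_imp a b := c_or (c_not a) b.

Section Qf.
Variable n : nat.

Lemma entry_tnth (A : structure 0) (t : n.-tuple A) i (lt : i < n) : entry t i = tnth t (Ordinal lt).
Proof. by rewrite (tnth_nth (dflt A)). Qed.

Lemma repQ_true : repQ n c_true (fun _ _ => True).
Proof. by exists (QTrue 0 n). Qed.

Lemma repQ_lt i j : i < n -> j < n ->
  repQ n (c_lt i j) (fun A s => prec (entry s i) (entry s j)).
Proof.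
move=> li lj; exists (QLt (Var 0 (Ordinal li)) (Var 0 (Ordinal lj))).
by split=> // A t; rewrite /= !entry_tnth.
Qed.

Lemma repQ_eq i j : i < n -> j < n ->
  repQ n (c_eq i j) (fun A s => entry s i = entry s j).
Proof.
move=> li lj; exists (QEq (Var 0 (Ordinal li)) (Var 0 (Ordinal lj))).
by split=> // A t; rewrite /= !entry_tnth.
Qed.

Lemma repQ_not a Q : repQ n a Q -> repQ n (c_not a) (fun A s => ~ Q A s).
Proof. by move=> [q [<- H]]; exists (QNot q); split=> // A t; rewrite /= H. Qed.

Lemma repQ_and a b Q Q' : repQ n a Q -> repQ n b Q' ->
  repQ n (c_and a b) (fun A s => Q A s /\ Q' A s).
Proof.
by move=> [q [<- H]] [q' [<- H']]; exists (QAnd q q'); split=> // A t; rewrite /= H H'.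
Qed.

Lemma repQ_or a b Q Q' : repQ n a Q -> repQ n b Q' ->
  repQ n (c_or a b) (fun A s => Q A s \/ Q' A s).
Proof.
by move=> [q [<- H]] [q' [<- H']]; exists (QOr q q'); split=> // A t; rewrite /= H H'.
Qed.

Lemma repQ_imp a b Q Q' : repQ n a Q -> repQ n b Q' ->
  repQ n (c_imp a b) (fun A s => Q A s -> Q' A s).
Proof.
move=> Ha Hb; apply: repQ_iff (repQ_or (repQ_not Ha) Hb) => A s _.
by split=> [[]|H] //; have [/H|] := classic (Q A s); [right | left].
Qed.

End Qf.

Lemma cpair_lt a b m : a < m -> b < m -> cpair a b < cpair m m.
Proof.
move=> am bm; have := Cantor.to_nat_spec a b; have := Cantor.to_nat_spec m m.
rewrite /cpair; nia.
Qed.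

(** Clause number [cpair a a'] says that the variable b + a is above the
    variable i and differs from b + a'.  Both indices are clamped below m: every
    number then gives a clause on the intended variables, and the clauses
    numbered below [cpair m m] include all pairs. *)
Definition c_above_clause i b m s :=
  c_and (c_lt i (b + minn (cleft s) m.-1))
    (if minn (cleft s) m.-1 == minn (cright s) m.-1 then c_true
     else c_not (c_eq (b + minn (cleft s) m.-1) (b + minn (cright s) m.-1))).
Definition c_above i b m :=
  iteri (cpair m m) (fun s w => c_and (c_above_clause i b m s) w) c_true.

Definition all_above (A : structure 0) (x : A) (u : nat -> A) (m : nat) : Prop :=
  forall a a', a < m -> a' < m -> prec x (u a) /\ (a <> a' -> u a <> u a').

Lemma repQ_above n i b m : i < n -> b + m <= n ->
  repQ n (c_above i b m) (fun A s => all_above (entry s i) (fun a => entry s (b + a)) m).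
Proof.
move=> lin lbn; case: m lbn => [|m] lbn.
  have -> : c_above i b 0 = c_true by [].
  by apply: repQ_iff (repQ_true n) => A s _; split.
pose P s (A : structure 0) (t : seq A) :=
  prec (entry t i) (entry t (b + minn (cleft s) m)) /\
  (minn (cleft s) m <> minn (cright s) m ->
    entry t (b + minn (cleft s) m) <> entry t (b + minn (cright s) m)).
have HP s : repQ n (c_above_clause i b m.+1 s) (P s).
  rewrite /c_above_clause /P /=; set a := minn _ _; set a' := minn _ _.
  have la : b + a < n by rewrite /a; lia.
  have la' : b + a' < n by rewrite /a'; lia.
  apply: repQ_and; first exact: repQ_lt.
  case: eqP => [->|N]; first by apply: repQ_iff (repQ_true n) => A t _; split.
  by apply: repQ_iff (repQ_not (repQ_eq la la')) => A t _; split=> // /(_ N).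
have Hc S : repQ n (iteri S (fun s w => c_and (c_above_clause i b m.+1 s) w) c_true)
    (fun A t => forall s, s < S -> P s A t).
  elim: S => [|S IH]; first by apply: repQ_iff (repQ_true n).
  apply: repQ_iff (repQ_and (HP S) IH) => A t _; split=> [[H1 H2] s|H].
    by rewrite ltnS leq_eqVlt => /orP[/eqP ->|/H2].
  by split=> [|s sS]; apply: H => //; apply: ltnW.
apply: repQ_iff (Hc _) => A t _; split=> [H a a' am a'm|H s _].
  have := H _ (cpair_lt am a'm); rewrite /P cleft_pair cright_pair.
  by have -> : minn a m = a by [lia]; have -> : minn a' m = a' by [lia].
by apply: H; lia.
Qed.

Lemma nth_listE T (d : T) s i : nth d s i = List.nth i s d.
Proof. by elim: s i => [|x s IH] [|i] //=. Qed.

Lemma above_all_above (A : structure 0) (x : A) m :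
  above (@prec 0 A) x m <-> exists u : seq A, size u = m /\ all_above x (entry u) m.
Proof.
split.
  case=> w [nd sw H]; exists w; split=> // a a' am a'm; split.
    by apply: H; rewrite /entry nth_listE; apply: List.nth_In; apply/ltP; rewrite -sw in am.
  move=> N E; apply: N; move: E; rewrite /entry !nth_listE.
  by move/(proj1 (List.NoDup_nth w (dflt A)) nd); apply; apply/ltP; rewrite -[List.length w]/(size w) sw.
case=> u [su H]; exists u; split=> //.
  apply/(List.NoDup_nth u (dflt A)) => a a' /ltP am /ltP a'm.
  rewrite -!nth_listE => E; apply: NNPP => N.
  have [_] := H a a' (eq_ind _ (fun m => a < m) am _ su) (eq_ind _ (fun m => a' < m) a'm _ su).
  by case.
move=> y /(List.In_nth _ _ (dflt A)) [a [/ltP am <-]]; rewrite -nth_listE.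
by case: (H a a (eq_ind _ (fun m => a < m) am _ su) (eq_ind _ (fun m => a < m) am _ su)).
Qed.

Lemma repP_qf n c Q : repQ n c Q -> repP n 0 (cpair 0 (cpair n c)) Q.
Proof. by case=> q [<- H]; exists (QF q); split=> //; apply: Pi_index_qf. Qed.

Lemma repS_fun n l l' i Q Q' (A : structure 0) (t : n.-tuple A) :
  repS n l i Q -> repS n l' i Q' -> Q A t -> Q' A t.
Proof.
move=> [phi [H HQ]] [phi' [H' HQ']] /HQ Ht; apply/HQ'.
by apply/(proj1 (index_sat 0 n) _ _ _ H _ _ H').
Qed.

Lemma repP_fun n l l' i Q Q' (A : structure 0) (t : n.-tuple A) :
  repP n l i Q -> repP n l' i Q' -> Q A t -> Q' A t.
Proof.
move=> [phi [H HQ]] [phi' [H' HQ']] /HQ Ht; apply/HQ'.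
by apply/(proj2 (index_sat 0 n) _ _ _ H _ _ H').
Qed.

Section Layer.
Variables (n l e : nat) (m j b : nat -> nat) (Q : nat -> spred).
Arguments Q : clear implicits.
Hypothesis We : forall x, W e x <-> exists z, x = cpair (m z) (j z).
Hypothesis bl : forall z, b z < l.

(* Several z may give the same x; they give equivalent bodies by [index_sat]. *)
Let pick x := epsilon (inhabits 0) (fun z => x = cpair (m z) (j z)).
Local Lemma pickP x : W e x -> cleft x = m (pick x) /\ cright x = j (pick x).
Proof.
move=> /We ex; have := epsilon_spec (inhabits 0) _ ex; rewrite -/(pick x) => E.
by rewrite {1 3}E cleft_pair cright_pair.
Qed.

Lemma repS_or :
  (forall z, repP (n + m z) (b z) (j z) (Q z)) ->
  repS n l (cpair 1 (cpair (fin_notation l) (cpair n e)))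
    (fun A s => exists z u, size u = m z /\ Q z A (s ++ u)).
Proof.
move=> H.
have ex x : exists psi : form 0 (n + cleft x), W e x ->
    Pi_index (fin_notation (b (pick x))) (cright x) psi /\
    forall (A : structure 0) (t : (n + cleft x).-tuple A), sat psi t <-> Q (pick x) A t.
  have [Wx|N] := classic (W e x); last by exists (QF (QTrue 0 _)).
  have [E1 E2] := pickP Wx; have := H (pick x); rewrite -E1 -E2.
  by case=> psi Hpsi; exists psi.
pose psi x := sval (constructive_indefinite_description _ (ex x)).
have psiP x := svalP (constructive_indefinite_description _ (ex x)).
exists (Or (W e) (fun x => Ex (psi x))); split.
  apply: (@Sigma_index_or 0 n _ e (fun x => fin_notation (b (pick x))) psi).
  - by have := bl 0; case: (l) => // ? _; apply: fin_notation_neq1.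
  - by move=> x _; apply: klt_fin_notation.
  - by move=> x Wx; case: (psiP x Wx).
move=> A t; split.
  case=> x [Wx [s Hs]]; exists (pick x), s; split.
    by rewrite size_tuple; case: (pickP Wx).
  by have [_ Hp] := psiP x Wx; move/Hp: Hs.
case=> z [u [su Hu]]; pose x := cpair (m z) (j z).
have Wx : W e x by apply/We; exists z.
exists x; split=> //.
have su' : size u == cleft x by rewrite su cleft_pair.
exists (Tuple su'); have [Hi Hp] := psiP x Wx; apply/Hp.
have Hz : repP (n + cleft x) (b z) (cright x) (Q z) by rewrite /x cleft_pair cright_pair.
have Hx : repP (n + cleft x) (b (pick x)) (cright x) (Q (pick x)) by exists (psi x).
by apply: (repP_fun Hz Hx).
Qed.

Lemma repP_and :
  (forall z, repS (n + m z) (b z) (j z) (Q z)) ->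
  repP n l (cpair 2 (cpair (fin_notation l) (cpair n e)))
    (fun A s => forall z u, size u = m z -> Q z A (s ++ u)).
Proof.
move=> H.
have ex x : exists psi : form 0 (n + cleft x), W e x ->
    Sigma_index (fin_notation (b (pick x))) (cright x) psi /\
    forall (A : structure 0) (t : (n + cleft x).-tuple A), sat psi t <-> Q (pick x) A t.
  have [Wx|N] := classic (W e x); last by exists (QF (QTrue 0 _)).
  have [E1 E2] := pickP Wx; have := H (pick x); rewrite -E1 -E2.
  by case=> psi Hpsi; exists psi.
pose psi x := sval (constructive_indefinite_description _ (ex x)).
have psiP x := svalP (constructive_indefinite_description _ (ex x)).
exists (And (W e) (fun x => All (psi x))); split.
  apply: (@Pi_index_and 0 n _ e (fun x => fin_notation (b (pick x))) psi).
  - by have := bl 0; case: (l) => // ? _; apply: fin_notation_neq1.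
  - by move=> x _; apply: klt_fin_notation.
  - by move=> x Wx; case: (psiP x Wx).
move=> A t; split; last first.
  move=> Ht x Wx s; have [_ Hp] := psiP x Wx; apply/Hp; apply: Ht.
  by rewrite size_tuple; case: (pickP Wx).
move=> Ht z u su; pose x := cpair (m z) (j z).
have Wx : W e x by apply/We; exists z.
have su' : size u == cleft x by rewrite su cleft_pair.
have [Hi Hp] := psiP x Wx; have /Hp := Ht x Wx (Tuple su').
have Hz : repS (n + cleft x) (b z) (cright x) (Q z) by rewrite /x cleft_pair cright_pair.
have Hx : repS (n + cleft x) (b (pick x)) (cright x) (Q (pick x)) by exists (psi x).
exact: (repS_fun Hx Hz).
Qed.

End Layer.

(** * Uniformly computable families of formulas *)

Ltac computable_step :=
  first
    [ exact: computable_const | exact: computable_id | assumption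
    | apply: computable_left | apply: computable_right
    | apply: computable_pair | apply: computable_succ | apply: computable_pred
    | apply: computable_add | apply: computable_sub | apply: computable_min
    | apply: computable_if_eq | apply: computable_if_le ].
Ltac solve_computable := repeat computable_step.

Lemma ce_singletons : exists E : nat -> nat, computable E /\
  forall v x, W (E v) x <-> x = v.
Proof.
have [|E [cE HE]] := @ce_ranges (fun p _ => p); first by solve_computable.
exists E; split=> // v x; rewrite HE; split; first by case.
by move=> ->; exists 0.
Qed.

Definition computable2 (f : nat -> nat -> nat) := computable (fun u => f (cleft u) (cright u)).

(** The conjuncts may depend on a parameter p; an index of the conjunction is
    then computable in p. *)
Lemma repP_family l (n : nat -> nat) (m j : nat -> nat -> nat) :
  computable n -> computable2 m -> computable2 j ->
  exists idx, computable idx /\ forall p (Q : nat -> spred),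
    (forall z, repS (n p + m p z) l (j p z) (Q z)) ->
    repP (n p) l.+1 (idx p)
      (fun A s => forall z u, size u = m p z -> Q z A (s ++ u)).
Proof.
move=> cn cm cj.
have [|E [cE HE]] := @ce_ranges (fun p z => cpair (m p z) (j p z)).
  exact: computable_pair cm cj.
exists (fun p => cpair 2 (cpair (fin_notation l.+1) (cpair (n p) (E p)))); split; first by solve_computable.
move=> p Q H; apply: (@repP_and (n p) l.+1 (E p) (m p) (j p) (fun=> l) Q) => //.
Qed.

Lemma repS_single l (n m j : nat -> nat) :
  computable n -> computable m -> computable j ->
  exists idx, computable idx /\ forall p (Q : spred),
    repP (n p + m p) l (j p) Q ->
    repS (n p) l.+1 (idx p) (fun A s => exists u, size u = m p /\ Q A (s ++ u)).
Proof.
move=> cn cm cj; have [E [cE HE]] := ce_singletons.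
exists (fun p => cpair 1 (cpair (fin_notation l.+1) (cpair (n p) (E (cpair (m p) (j p)))))).
split; first by solve_computable; apply: (computable_comp cE); solve_computable.
move=> p Q H.
apply: (@repS_iff (n p) l.+1 _ (fun A s => exists (z : nat) u, size u = m p /\ Q A (s ++ u))).
  move=> A s _; split; first by case=> _ H'.
  by exists 0.
apply: (@repS_or (n p) l.+1 _ (fun=> m p) (fun=> j p) (fun=> l) (fun=> Q)) => //.
move=> x; rewrite HE; split; first by move=> ->; exists 0.
by case.
Qed.

(** The Sigma_1 parts are single existential formulas, that is, disjunctions
    over singletons. *)
Lemma repP2_family (n : nat -> nat) (m m' q : nat -> nat -> nat) :
  computable n -> computable2 m -> computable2 m' -> computable2 q ->
  exists idx, computable idx /\ forall p (Q : nat -> spred),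
    (forall z, repQ (n p + m p z + m' p z) (q p z) (Q z)) ->
    repP (n p) 2 (idx p)
      (fun A s => forall z w, size w = m p z -> exists u, size u = m' p z /\ Q z A (s ++ w ++ u)).
Proof.
move=> cn cm cm' cq.
pose N u := n (cleft u) + m (cleft u) (cright u).
have cN : computable N by apply: computable_add => //; apply: (computable_comp cn); solve_computable.
have [|j [cj Hj]] := @repS_single 0 N (fun u => m' (cleft u) (cright u))
  (fun u => cpair 0 (cpair (N u + m' (cleft u) (cright u)) (q (cleft u) (cright u)))) cN cm'.
  by solve_computable.
have [|idx [ci Hi]] := @repP_family 1 n m (fun p z => j (cpair p z)) cn cm.
  by apply: (computable_comp cj); solve_computable.
exists idx; split=> // p Q H.
pose Q' z : spred := fun A s => exists u, size u = m' p z /\ Q z A (s ++ u).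
apply: repP_iff (Hi p Q' _) => [A s _|z].
  by split=> Hs z w /Hs [u [su Hu]]; exists u; [rewrite catA|rewrite -catA].
have := Hj (cpair p z); rewrite /N !(cleft_pair, cright_pair); apply.
exact: repP_qf (H z).
Qed.

Lemma computable_c_above i b m : computable i -> computable b -> computable m ->
  computable (fun x => c_above (i x) (b x) (m x)).
Proof.
move=> ci cb cm.
apply: (@computable_iteri _ (fun x s w => c_and (c_above_clause (i x) (b x) (m x) s) w)).
- by solve_computable.
- exact: computable_const.
have ci' := computable_comp ci (computable_left computable_id).
have cb' := computable_comp cb (computable_left computable_id).
have cm' := computable_comp cm (computable_left computable_id).
by rewrite /c_and /c_above_clause /c_and /c_lt /c_not /c_eq; solve_computable.
Qed.

Lemma computable_parent f : computable f -> computable (fun x => parent predT (f x)).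
Proof.
move=> cf; apply: (@computable_ext (fun x => if f x == 0 then 0 else
   if cleft (f x).-1 == 0 then 0 else if cleft (f x).-1 == 1 then 0 else
   if cleft (f x).-1 == 2 then
     (cpair 0 (cpair (cleft (cleft (cright (f x).-1)) + (cright (cleft (cright (f x).-1))).+1)
        (cright (cright (f x).-1)))).+1
   else (cpair 1 (cleft (f x).-1 - 3)).+1)).
  move=> x; case: (f x) => //= y; rewrite /nodeA /nodeB.
  by case: (cleft y) => [|[|[|j]]] //; rewrite /= ?subSS ?subn0.
by solve_computable.
Qed.

(** A decision procedure for [above] in the canonical tree, with values 0 and 1. *)
Definition has_above (x m : nat) : nat :=
  if x == 0 then 1 else if cleft x.-1 == 0 then (if m <= cleft (cright x.-1) then 1 else 0)
  else if cleft x.-1 == 1 then 1 else if m == 0 then 1 else 0.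

Lemma has_aboveP x m : above (tree_rel predT) x m <-> has_above x m = 1.
Proof.
have leaf p y : lev1 (tree_rel predT) 0 p -> tree_rel predT p y ->
    (above (tree_rel predT) y m <-> (if m == 0 then 1 else 0) = 1).
  move=> Hp py; rewrite (lev2_leaf (tree_shallow predT) Hp py m).
  by rewrite leqn0; case: (m == 0).
case: (nodeP x) => [|k j|j|d i j|j i].
- by split=> // _; apply/(tree_deg_root predT m).
- rewrite (tree_degA predT k j m) /has_above /nodeA /= cleft_pair /= cright_pair cleft_pair.
  by case: (m <= k).
- by rewrite (tree_degB (Q := predT) (j := j) isT m) /has_above /nodeB /= cleft_pair.
- rewrite (leaf (nodeA (d + i.+1) j)) ?/has_above /leafA /= ?cleft_pair //; first exact: lev1A.
  by split=> //; right; rewrite parentE.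
- rewrite (leaf (nodeB j)) ?/has_above /leafB /= ?cleft_pair //; first exact: lev1B.
  by split=> //; right; rewrite parentE.
Qed.

Lemma computable_has_above f g : computable f -> computable g ->
  computable (fun x => has_above (f x) (g x)).
Proof. by move=> cf cg; rewrite /has_above; solve_computable. Qed.

Lemma canonical_computable : computable_rel (@prec 0 canonical_A2).
Proof.
have [c Hc] : computable (fun u => if cright u == 0 then 0 else
    if cleft u == 0 then 1 else if cleft u == parent predT (cright u) then 1 else 0).
  by solve_computable; apply: computable_parent; solve_computable.
exists c => x y.
have [H|H] := classic (tree_rel predT x y); [left|right]; (split; first by
  [apply/canonical_prec | move/canonical_prec]); apply/Hc; rewrite cleft_pair cright_pair.
  by case: H => /eqP/negbTE -> [->|->] //; rewrite eqxx if_same.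
case: eqP => // y0; case: eqP => [x0|x0]; first by case: H; split=> //; left.
by case: eqP => // xy; case: H; split=> //; right.
Qed.

(** * The type of a finite part of the tree *)

(** A parameter p packs the number [arity p] of free variables, a bound M and a
    sequence of numbers.  The part of the tree described by p is the sequence
    of nodes [parent 0], 0, [parent 1], 1, ..., [parent M], M, which is closed
    under parents; [vertex x e] is one of its entries, and [pos p x e] the
    variable naming it.  The free variables name the nodes [target p i], clamped
    to the bound M so that every p is meaningful. *)
Definition arity (p : nat) := cleft p.
Definition bound (p : nat) := cleft (cright p).
Definition lookup (c i : nat) := cleft (iter i cright c).
Definition target (p i : nat) := minn (lookup (cright (cright p)) i) (bound p).
Definition len (p : nat) := arity p + (bound p + bound p).+2.
Definition pos (p x e : nat) := arity p + (x + x + e).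
Definition vertex (x e : nat) := if e == 0 then parent predT x else x.

(** Besides equalities and degrees only the pairs formed by a parent and its
    child are described: as the part is closed under parents, they determine
    the order.  The absence of intermediate nodes in [dg_child] is what separates
    level-one nodes without children from leaves. *)
Record diagram (p : nat) (A : structure 0) (s : seq A) : Prop := Diagram {
  dg_tree : shallow (@prec 0 A) (entry s (pos p 0 0));
  dg_child : forall x, 0 < x -> x <= bound p ->
    prec (entry s (pos p x 0)) (entry s (pos p x 1)) /\
    forall w, ~ (prec (entry s (pos p x 0)) w /\ prec w (entry s (pos p x 1)));
  dg_eq : forall x e x' e', x <= bound p -> x' <= bound p -> e <= 1 -> e' <= 1 ->
    (vertex x e = vertex x' e' <-> entry s (pos p x e) = entry s (pos p x' e'));
  dg_above : forall x e m, x <= bound p -> e <= 1 ->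
    (above (@prec 0 A) (entry s (pos p x e)) m <-> above (tree_rel predT) (vertex x e) m);
  dg_tuple : forall i, i < arity p -> entry s i = entry s (pos p (target p i) 1)
}.

Definition c_tree r n :=
  c_and (c_not (c_lt n n))
 (c_and (c_imp (c_and (c_lt n n.+1) (c_lt n.+1 n.+2)) (c_lt n n.+2))
 (c_and (c_imp (c_and (c_lt n.+1 n) (c_lt n.+2 n))
               (c_or (c_lt n.+1 n.+2) (c_or (c_eq n.+1 n.+2) (c_lt n.+2 n.+1))))
 (c_and (c_not (c_and (c_lt n n.+1) (c_and (c_lt n.+1 n.+2) (c_lt n.+2 n.+3))))
        (c_or (c_eq n r) (c_lt r n))))).

Definition tree_axioms (A : structure 0) (r a b c d : A) : Prop :=
  ~ prec a a /\
  ((prec a b /\ prec b c -> prec a c) /\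
  ((prec b a /\ prec c a -> prec b c \/ (b = c \/ prec c b)) /\
  (~ (prec a b /\ (prec b c /\ prec c d)) /\
  (a = r \/ prec r a)))).

Lemma repQ_tree r n N : r < N -> n + 4 <= N ->
  repQ N (c_tree r n) (fun A s => tree_axioms (entry s r) (entry s n) (entry s n.+1)
    (entry s n.+2) (entry s n.+3)).
Proof.
move=> rN nN.
have h0 : n < N by lia.
have h1 : n.+1 < N by lia.
have h2 : n.+2 < N by lia.
have h3 : n.+3 < N by lia.
rewrite /c_tree /tree_axioms.
by repeat lazymatch goal with
   | |- repQ _ (c_lt _ _) _ => apply: repQ_lt
   | |- repQ _ (c_eq _ _) _ => apply: repQ_eq
   | |- repQ _ (c_not _) _ => apply: repQ_not
   | |- repQ _ (c_and _ _) _ => apply: repQ_and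
   | |- repQ _ (c_or _ _) _ => apply: repQ_or
   | |- repQ _ (c_imp _ _) _ => apply: repQ_imp
   end.
Qed.

Lemma tree_axioms_shallow (A : structure 0) (r : A) :
  (forall a b c d, tree_axioms r a b c d) <-> shallow (@prec 0 A) r.
Proof.
split=> [H|sh a b c d].
  split.
  - by move=> a; case: (H a a a a).
  - by move=> a b c ab bc; case: (H a b c a) => _ [H' _]; apply: H'.
  - move=> a b c ab ac; case: (H a b c a) => _ [_ [H' _]].
    by case: (H' (conj ab ac)) => [|[]]; [constructor 1|constructor 2|constructor 3].
  - by move=> a b c d ab bc cd; case: (H a b c d) => _ [_ [_ [H' _]]]; apply: H'.
  - by move=> a; case: (H a a a a) => _ [_ [_ [_ H']]].
split; first exact: sh_irr sh _.
split; first by case; apply: sh_trans sh _ _ _.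
split; first by case=> ba ca; case: (sh_lin sh ba ca); auto.
split; first by case=> ab [bc cd]; apply: sh_hgt sh _ _ _ _ ab bc cd.
exact: sh_root sh _.
Qed.

(** A number i stands for the entry with coordinates x and e, where i = <x, e>. *)
Definition px p i := minn (cleft i) (bound p).
Definition pe i := minn (cright i) 1.
Definition ppos p i := pos p (px p i) (pe i).
Definition pvert p i := vertex (px p i) (pe i).

(** The conjuncts of a diagram are numbered by z = <kind, <a, b>>.  Kind 0 is
    the axioms of trees, kind 1 a pair of parent and child, kind 2 an equality
    or inequality between entries a and b, kind 3 whether entry a has b elements
    above it, and the other kinds say what the free variable a names.  Conjunct
    z is: for all blocks of [clause_forall p z] variables there is a block of
    [clause_exists p z] variables satisfying the formula coded by
    [clause_matrix p z], whose meaning is [clause_sem p z]. *)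
Definition clause_forall p z :=
  let a := cleft (cright z) in let b := cright (cright z) in
  if cleft z == 0 then 4 else if cleft z == 1 then 1 else
  if cleft z == 3 then (if has_above (pvert p a) b == 1 then 0 else b) else 0.

Definition clause_exists p z :=
  let a := cleft (cright z) in let b := cright (cright z) in
  if cleft z == 3 then (if has_above (pvert p a) b == 1 then b else 0) else 0.

Definition clause_matrix p z :=
  let a := cleft (cright z) in let b := cright (cright z) in
  if cleft z == 0 then c_tree (pos p 0 0) (len p) else
  if cleft z == 1 then
    (if minn a (bound p) == 0 then c_true else
     c_and (c_lt (pos p (minn a (bound p)) 0) (pos p (minn a (bound p)) 1))
       (c_not (c_and (c_lt (pos p (minn a (bound p)) 0) (len p))
                     (c_lt (len p) (pos p (minn a (bound p)) 1))))) else
  if cleft z == 2 then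
    (if pvert p a == pvert p b then c_eq (ppos p a) (ppos p b)
     else c_not (c_eq (ppos p a) (ppos p b))) else
  if cleft z == 3 then
    (if has_above (pvert p a) b == 1 then c_above (ppos p a) (len p) b
     else c_not (c_above (ppos p a) (len p) b)) else
  if a.+1 <= arity p then c_eq a (pos p (target p a) 1) else c_true.

Definition clause_sem p z : spred := fun A s =>
  let a := cleft (cright z) in let b := cright (cright z) in
  let en := entry s in
  if cleft z == 0 then tree_axioms (en (pos p 0 0)) (en (len p)) (en (len p).+1)
    (en (len p).+2) (en (len p).+3) else
  if cleft z == 1 then
    (if minn a (bound p) == 0 then True else
     prec (en (pos p (minn a (bound p)) 0)) (en (pos p (minn a (bound p)) 1)) /\
     ~ (prec (en (pos p (minn a (bound p)) 0)) (en (len p)) /\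
        prec (en (len p)) (en (pos p (minn a (bound p)) 1)))) else
  if cleft z == 2 then
    (if pvert p a == pvert p b then en (ppos p a) = en (ppos p b)
     else ~ en (ppos p a) = en (ppos p b)) else
  if cleft z == 3 then
    (if has_above (pvert p a) b == 1
     then all_above (en (ppos p a)) (fun i => en (len p + i)) b
     else ~ all_above (en (ppos p a)) (fun i => en (len p + i)) b) else
  if a.+1 <= arity p then en a = en (pos p (target p a) 1) else True.

Lemma pos_len p x e : x <= bound p -> e <= 1 -> pos p x e < len p.
Proof. by rewrite /pos /len; lia. Qed.

Lemma ppos_len p i : ppos p i < len p.
Proof. by apply: pos_len; rewrite ?/px ?/pe geq_minr. Qed.

Lemma clause_rep p z :
  repQ (len p + clause_forall p z + clause_exists p z) (clause_matrix p z) (clause_sem p z).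
Proof.
rewrite /clause_forall /clause_exists /clause_matrix /clause_sem.
move: (cleft (cright z)) (cright (cright z)) => a b.
have pl x e := @pos_len p x e.
have ppl i := ppos_len p i.
case: (cleft z) => [|[|[|[|k]]]] /=.
- by apply: repQ_tree; [have := pl 0 0; lia | lia].
- set x := minn a _; have xb : x <= bound p by apply: geq_minr.
  have := pl x 0 xb isT; have := pl x 1 xb isT => h1 h0.
  case: (x == 0); first exact: repQ_true.
  by apply: repQ_and; [apply: repQ_lt; lia | apply: repQ_not; apply: repQ_and; apply: repQ_lt; lia].
- have := ppl a; have := ppl b => hb ha.
  by case: ifP => _; [| apply: repQ_not]; apply: repQ_eq; lia.
- have := ppl a => ha.
  by case: ifP => _; [| apply: repQ_not]; apply: repQ_above; lia.
- case: ifP => H; last exact: repQ_true.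
  have := pl (target p a) 1 (geq_minr _ _) isT => h.
  by apply: repQ_eq; rewrite /len; rewrite /len in h; lia.
Qed.

Lemma computable_len : computable len.
Proof. by rewrite /len /arity /bound; solve_computable. Qed.

Lemma computable_pos p x e : computable p -> computable x -> computable e ->
  computable (fun u => pos (p u) (x u) (e u)).
Proof. by move=> *; rewrite /pos /arity; solve_computable. Qed.

Lemma computable_px p x : computable p -> computable x -> computable (fun u => px (p u) (x u)).
Proof. by move=> *; rewrite /px /bound; solve_computable. Qed.

Lemma computable_ppos p x : computable p -> computable x -> computable (fun u => ppos (p u) (x u)).
Proof.
by move=> *; apply: computable_pos => //; rewrite /pe; solve_computable; apply: computable_px.
Qed.

Lemma computable_pvert p x : computable p -> computable x -> computable (fun u => pvert (p u) (x u)).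
Proof.
move=> cp cx; rewrite /pvert /vertex /pe; solve_computable; try exact: computable_px.
by apply: computable_parent; apply: computable_px.
Qed.

Lemma computable_lookup c i : computable c -> computable i ->
  computable (fun u => lookup (c u) (i u)).
Proof.
move=> cc ci; apply: computable_left.
by apply: (computable_iter (f := cright) ci _ cc) => //; solve_computable.
Qed.

Lemma computable_target p i : computable p -> computable i ->
  computable (fun u => target (p u) (i u)).
Proof.
move=> cp ci; apply: computable_min; last by rewrite /bound; solve_computable.
by apply: computable_lookup => //; solve_computable.
Qed.

Lemma computable_bound p : computable p -> computable (fun u => bound (p u)).
Proof. by move=> cp; rewrite /bound; solve_computable. Qed.

Lemma computable_len_comp p : computable p -> computable (fun u => len (p u)).
Proof. exact: (computable_comp computable_len). Qed.

Ltac computable_diagram :=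
  repeat first
   [ apply: computable_len_comp | apply: computable_bound
   | apply: computable_pos | apply: computable_ppos | apply: computable_pvert
   | apply: computable_c_above | apply: computable_has_above | apply: computable_target
   | computable_step ].

Lemma computable_clause_forall : computable2 clause_forall.
Proof. by rewrite /computable2 /clause_forall; computable_diagram. Qed.

Lemma computable_clause_exists : computable2 clause_exists.
Proof. by rewrite /computable2 /clause_exists; computable_diagram. Qed.

Lemma computable_clause_matrix : computable2 clause_matrix.
Proof.
rewrite /computable2 /clause_matrix /c_tree /c_lt /c_eq /c_not /c_and /c_imp /c_or /c_not /arity.
by computable_diagram.
Qed.

Lemma entry_catl (A : structure 0) (s r : seq A) i : i < size s -> entry (s ++ r) i = entry s i.
Proof. by move=> H; rewrite /entry nth_cat H. Qed.

Lemma entry_catr (A : structure 0) (s r : seq A) n i :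
  size s = n -> entry (s ++ r) (n + i) = entry r i.
Proof. by move=> <-; rewrite /entry nth_cat ltnNge leq_addr /= addKn. Qed.

Lemma clauses_diagram p (A : structure 0) (s : seq A) : size s = len p ->
  (forall z w, size w = clause_forall p z ->
    exists u, size u = clause_exists p z /\ @clause_sem p z A (s ++ w ++ u)) <-> diagram p s.
Proof.
move=> ss.
have el r i : i < len p -> entry (s ++ r) i = entry s i.
  by rewrite -ss; apply: entry_catl.
have er r i : entry (s ++ r) (len p + i) = entry r i by apply: entry_catr.
have er0 r : entry (s ++ r) (len p) = entry r 0 by rewrite -(er r 0) addn0.
have er1 r : entry (s ++ r) (len p).+1 = entry r 1 by rewrite -(er r 1) addn1.
have er2 r : entry (s ++ r) (len p).+2 = entry r 2 by rewrite -(er r 2) addn2.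
have er3 r : entry (s ++ r) (len p).+3 = entry r 3 by rewrite -(er r 3) addn3.
have pl x e := @pos_len p x e.
have ppl i := ppos_len p i.
have er' w u i : i < size w -> entry (s ++ w ++ u) (len p + i) = entry w i.
  by move=> H; rewrite er entry_catl.
have px_pair x e : x <= bound p -> e <= 1 -> pvert p (cpair x e) = vertex x e /\
    ppos p (cpair x e) = pos p x e.
  move=> hx he; rewrite /pvert /ppos /px /pe cleft_pair cright_pair.
  by have -> : minn x (bound p) = x by [lia]; have -> : minn e 1 = e by [lia].
split=> [H|dg].
- have H' k a b w : size w = clause_forall p (cpair k (cpair a b)) ->
     exists u, size u = clause_exists p (cpair k (cpair a b)) /\
       @clause_sem p (cpair k (cpair a b)) A (s ++ w ++ u) by apply: H.
  split.
  + apply/tree_axioms_shallow => a b c d.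
    have [] := H' 0 0 0 [:: a; b; c; d]; rewrite /clause_forall /clause_exists /clause_sem !cleft_pair //=.
    move=> u [_]; rewrite (el _ (pos p 0 0)) ?pl //.
    by rewrite er0 er1 er2 er3.
  + move=> x x0 xb.
    have K w : prec (entry s (pos p x 0)) (entry s (pos p x 1)) /\
      ~ (prec (entry s (pos p x 0)) w /\ prec w (entry s (pos p x 1))).
      have [] := H' 1 x 0 [:: w]; rewrite /clause_forall /clause_exists /clause_sem
        !(cleft_pair, cright_pair) //=.
      have -> : minn x (bound p) = x by lia.
      move=> u [_]; rewrite (negbTE (lt0n_neq0 x0)).
      by rewrite !er0 !el ?pl.
    by split=> [|w]; [case: (K (entry s 0)) | case: (K w)].
  + move=> x e x' e' hx hx' he he'.
    have [] := H' 2 (cpair x e) (cpair x' e') [::]; rewrite /clause_forall /clause_exists /clause_sem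
        !(cleft_pair, cright_pair) //=.
    have [-> ->] := px_pair _ _ hx he; have [-> ->] := px_pair _ _ hx' he'.
    by move=> u [_]; rewrite !el ?pl //; case: eqP.
  + move=> x e m hx he.
    have := H' 3 (cpair x e) m; rewrite /clause_forall /clause_exists /clause_sem
        !(cleft_pair, cright_pair) //=.
    have [-> ->] := px_pair _ _ hx he; rewrite has_aboveP.
    case: eqP => E /=.
      case/(_ [::]) => // u [su]; rewrite el ?pl // => Hu; split=> // _.
      apply/above_all_above; exists u; split=> // a a' am a'm.
      by have := Hu a a' am a'm; rewrite !er.
    move=> K; split=> // /above_all_above [w [sw Hw]].
    have [u [su []]] := K w sw; rewrite el ?pl // => a a' am a'm.
    by rewrite !er' ?sw //; apply: Hw.
  + move=> i hi.
    have [] := H' 4 i 0 [::]; rewrite /clause_forall /clause_exists /clause_sem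
        !(cleft_pair, cright_pair) //=.
    have h1 : pos p (target p i) 1 < len p by apply: pl => //; apply: geq_minr.
    have h2 : i < len p by rewrite /len; lia.
    by move=> u [_]; rewrite hi (el _ _ h1) (el _ _ h2).
- case: dg => d1 d2 d3 d4 d5 z; rewrite /clause_forall /clause_exists /clause_sem.
  move: (cleft (cright z)) (cright (cright z)) => a b.
  case: (cleft z) => [|[|[|[|k]]]] /= w sw.
  + exists [::]; split=> //; rewrite (el _ (pos p 0 0)) ?pl //.
    exact: (proj2 (tree_axioms_shallow _) d1).
  + exists [::]; split=> //; case: eqP => // x0.
    set x := minn _ _ in x0 *; have xb : x <= bound p by apply: geq_minr.
    rewrite !(el _ (pos p x _)) ?pl //.
    by have [K1 K2] := d2 x (ltac:(lia)) xb; split=> //; apply: K2.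
  + exists [::]; split=> //; rewrite !el //.
    have := d3 (px p a) (pe a) (px p b) (pe b).
    rewrite -/(pvert p a) -/(pvert p b) -/(ppos p a) -/(ppos p b) => K.
    have {}K := K (geq_minr _ _) (geq_minr _ _) (geq_minr _ _) (geq_minr _ _).
    by case: eqP => [/K|N] // /K.
  + have := d4 (px p a) (pe a) b (geq_minr _ _) (geq_minr _ _).
    rewrite -/(pvert p a) -/(ppos p a) has_aboveP => K.
    case: eqP sw => E sw.
      have /above_all_above [u [su Hu]] := proj2 K E; exists u; split=> //.
      rewrite el // => i i' ib i'b.
      by rewrite (size0nil sw) /= !er; apply: Hu.
    exists [::]; split=> //; rewrite el // => Hw; apply: E; apply/K.
    apply/above_all_above; exists w; split=> // i i' ib i'b.
    by have := Hw i i' ib i'b; rewrite !er' ?sw.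
  + exists [::]; split=> //; case: ifP => // ia.
    have h1 : pos p (target p a) 1 < len p by apply: pl => //; apply: geq_minr.
    have h2 : a < len p by rewrite /len; lia.
    rewrite (el _ _ h1) (el _ _ h2); exact: d5.
Qed.

(** Truth in the canonical tree of each conjunct of kind 2 or 3 is decidable,
    so the conjuncts are computable in p and z. *)
Lemma diagram_Pi2 : exists idx, computable idx /\ forall p, repP (len p) 2 (idx p) (@diagram p).
Proof.
have [idx [ci H]] := repP2_family computable_len computable_clause_forall
  computable_clause_exists computable_clause_matrix.
exists idx; split=> // p; apply: repP_iff (H p (clause_sem p) (clause_rep p)) => A s.
exact: clauses_diagram.
Qed.

Section Diagram.
Variables (p : nat) (A : structure 0) (s : seq A).
Hypothesis dg : diagram p s.
Local Notation R := (@prec 0 A).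
Local Notation T := (tree_rel predT).
Local Notation Y x e := (entry s (pos p x e)).
Local Notation r := (Y 0 0).
Local Notation M := (bound p).

Let sh := dg_tree dg.

Lemma dg_root x e : x <= M -> e <= 1 -> (vertex x e = 0 <-> Y x e = r).
Proof. by move=> hx he; apply: (dg_eq dg (x' := 0) (e' := 0)). Qed.

Lemma dg_lev1 x e : x <= M -> e <= 1 -> lev1 T 0 (vertex x e) -> lev1 R r (Y x e).
Proof.
move=> hx he /tree_lev1 [u0 pu].
have Yr : Y x e <> r by move/(dg_root hx he).
have rY : R r (Y x e) by case: (sh_root sh (Y x e)).
split=> // z zY; case: (sh_root sh z) => // rz.
case: e he u0 pu {Yr rY} zY => [|[|//]] he u0 pu zY.
  have x0 : 0 < x by case: (x) u0.
  (* The number [parent x] may exceed the bound, and is then not described as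
     a child of the root; but it has x above it, which leaves no room below. *)
  by case: (dg_child dg x0 hx) => xx _; case: (sh_hgt sh rz zY xx).
have x0 : 0 < x by case: (x) u0.
case: (dg_child dg x0 hx) => _ /(_ z); case; split=> //.
by have /(dg_root hx (isT : 0 <= 1)) -> : vertex x 0 = 0.
Qed.

Lemma dg_parent_lev1 x : x <= M -> parent predT x <> 0 -> lev1 R r (Y x 0).
Proof.
by move=> hx px; apply: dg_lev1 => //; apply/tree_lev1; rewrite /vertex /= parent_parent.
Qed.

Lemma dg_cases x e : x <= M -> e <= 1 ->
  [\/ vertex x e = 0, lev1 T 0 (vertex x e) | e = 1 /\ parent predT x <> 0].
Proof.
move=> hx he; case: e he => [|[|//]] _.
  have [->|/eqP N] := eqVneq (vertex x 0) 0; first by constructor 1.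
  by constructor 2; apply/tree_lev1; rewrite /vertex /= parent_parent.
have [->|/eqP N] := eqVneq x 0; first by constructor 1.
have [E|/eqP N'] := eqVneq (parent predT x) 0; last by constructor 3.
by constructor 2; apply/tree_lev1.
Qed.

Lemma dg_lev2 x : x <= M -> parent predT x <> 0 ->
  forall z, R z (Y x 1) <-> z = r \/ z = Y x 0.
Proof.
move=> hx px z; have x0 : 0 < x by case: (x) px.
have [xx _] := dg_child dg x0 hx; have Hp := dg_parent_lev1 hx px.
split; first exact: lev2_pred Hp xx.
by case=> -> //; apply: (sh_trans sh) xx; case: Hp.
Qed.

Lemma dg_rel x e x' e' : x <= M -> x' <= M -> e <= 1 -> e' <= 1 ->
  (T (vertex x e) (vertex x' e') <-> R (Y x e) (Y x' e')).
Proof.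
move=> hx hx' he he'; case: (dg_cases hx' he') => [E|L|[E px]].
- have /(dg_root hx' he') -> := E; rewrite E.
  by split=> [[]|/(root_min sh)].
- split=> [[_ H]|H].
    have [_ p0] := proj1 (tree_lev1 _ _) L; rewrite p0 in H.
    have /(dg_root hx he) -> : vertex x e = 0 by case: H.
    by case: (dg_lev1 hx' he' L).
  have /(dg_root hx he) -> : Y x e = r by apply: (proj2 (dg_lev1 hx' he' L)).
  by split; [case: (proj1 (tree_lev1 _ _) L) | left].
- rewrite E dg_lev2 // -dg_root //.
  have -> : Y x e = Y x' 0 <-> vertex x e = vertex x' 0 by rewrite -(dg_eq dg).
  rewrite /T /vertex /=; split=> [[]|H]; first by [].
  by split=> // x0; apply: px; rewrite x0.
Qed.

Definition dg_map : seq (nat * A) :=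
  List.map (fun x => (vertex x 0, Y x 0)) (List.seq 0 M.+1) ++
  List.map (fun x => (vertex x 1, Y x 1)) (List.seq 0 M.+1).

Lemma In_dg_map u y : List.In (u, y) dg_map <->
  exists x e, [/\ x <= M, e <= 1, u = vertex x e & y = Y x e].
Proof.
rewrite /dg_map In_cat !List.in_map_iff; split.
  case=> [] [x [[<- <-] /List.in_seq Hx]].
    by exists x, 0; split=> //; lia.
  by exists x, 1; split=> //; lia.
case=> x [[|[|e]] [hx he -> ->]] //; [left|right]; exists x; split=> //; apply/List.in_seq; lia.
Qed.

Lemma dg_part_map : part_map T R 0 r (same_deg T R) dg_map.
Proof.
split.
- by apply/In_dg_map; exists 0, 0.
- move=> u u' y y' /In_dg_map [x [e [hx he -> ->]]] /In_dg_map [x' [e' [hx' he' -> ->]]].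
  exact: (dg_eq dg).
- move=> u u' y y' /In_dg_map [x [e [hx he -> ->]]] /In_dg_map [x' [e' [hx' he' -> ->]]].
  exact: dg_rel.
- move=> u y /In_dg_map [x [e [hx he -> ->]]] m.
  by rewrite (dg_above dg).
- move=> u y z /In_dg_map [x [e [hx he -> _]]].
  case=> u0 [->|->]; first by exists r; apply/In_dg_map; exists 0, 0.
  have [/= |L|[-> px]] := dg_cases hx he => //.
    have [_ ->] := proj1 (tree_lev1 _ _) L.
    by exists r; apply/In_dg_map; exists 0, 0.
  by exists (Y x 0); apply/In_dg_map; exists x, 0.
- move=> u y z /In_dg_map [x [e [hx he _ ->]]].
  have [/(dg_root hx he) ->|L|[-> px]] := dg_cases hx he.
  + by move/(root_min sh).
  + move/(proj2 (dg_lev1 hx he L)) => ->.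
    by exists 0; apply/In_dg_map; exists 0, 0.
  + move/(dg_lev2 hx px) => [->|->].
      by exists 0; apply/In_dg_map; exists 0, 0.
    by exists (vertex x 0); apply/In_dg_map; exists x, 0.
Qed.

End Diagram.

Lemma shallow_root_uniq T (R : T -> T -> Prop) r r' : shallow R r -> shallow R r' -> r = r'.
Proof.
move=> sh sh'; case: (sh_root sh r') => // rr'.
by case: (root_min sh' rr').
Qed.

(** A large diagram contains more nodes of a given degree than a given list has
    entries.  All diagrams share the same root, because a least element is
    unique. *)
Lemma diagrams_rich (A : structure 0) :
  (forall N, exists p s, bound p = N /\ @diagram p A s) ->
  exists r, rich (@prec 0 A) r.
Proof.
move=> H; have [p0 [s0 [_ dg0]]] := H 0.
exists (entry s0 (pos p0 0 0)); split; first exact: dg_tree dg0.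
move=> c L.
pose x j := if c is Some d then nodeA d j else nodeB j.
have x_inj j j' : x j = x j' -> j = j'.
  by rewrite /x; case: (c) => [d /nodeA_inj []|/nodeB_inj].
have x_lev j : lev1 (tree_rel predT) 0 (x j).
  by rewrite /x; case: (c) => [d|]; [apply: lev1A | apply: lev1B].
have x_deg j : deg_is (tree_rel predT) (x j) c.
  by rewrite /x; case: (c) => [d|]; [apply: tree_degA | apply: tree_degB].
have [N HN] := list_bound (List.map x (List.seq 0 (size L).+1)).
have [p [s [bN dg]]] := H N.
have -> := shallow_root_uniq (dg_tree dg0) (dg_tree dg).
have xN j : j <= size L -> x j <= bound p.
  move=> jL; rewrite bN ltnW //; apply: HN; apply/List.in_map_iff.
  by exists j; split=> //; apply/List.in_seq; lia.
pose Y j := entry s (pos p (x j) 1).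
have [j [jL NL]] : exists j, j <= size L /\ ~ List.In (Y j) L.
  apply: pigeonhole => j j' hj hj' E; apply: x_inj.
  exact: (proj2 (dg_eq dg (xN j hj) (xN j' hj') (isT : 1 <= 1) (isT : 1 <= 1)) E).
exists (Y j); split=> //.
  exact: (dg_lev1 dg (xN j jL) (isT : 1 <= 1) (x_lev j)).
by move=> m; rewrite (dg_above dg) ?xN //; apply: x_deg.
Qed.

Lemma diagram_iso p (A : structure 0) (s : seq A) :
  countable A -> (exists r, rich (@prec 0 A) r) -> diagram p s ->
  exists f : tree_struct predT -> A, is_iso f /\
    forall x, x <= bound p -> f x = entry s (pos p x 1).
Proof.
move=> cA [r riA] dg.
have E := shallow_root_uniq (proj1 riA) (dg_tree dg); rewrite E in riA.
have cN : countable nat by exists id.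
have [f [bf fR fl]] := rich_iso cN cA tree_rich riA (dg_part_map dg).
exists f; split; first by split=> //; rewrite [LHS]tuple0 [RHS]tuple0.
by move=> x hx; apply: fl; apply/In_dg_map; exists x, 1.
Qed.

(** Position [pos p x e] is [arity p + (2 * x + e)], which is read off by halving. *)
Definition standard_tuple (p : nat) : seq (tree_struct predT) :=
  [seq (if i < arity p then target p i else vertex (i - arity p)./2 (odd (i - arity p)))
   | i <- iota 0 (len p)].

Lemma size_standard p : size (standard_tuple p) = len p.
Proof. by rewrite size_map size_iota. Qed.

Lemma entry_standard p i : i < len p -> entry (standard_tuple p) i =
  if i < arity p then target p i else vertex (i - arity p)./2 (odd (i - arity p)).
Proof. by move=> H; rewrite /entry (nth_map 0) ?size_iota // nth_iota. Qed.

Lemma standard_pos p x e : x <= bound p -> e <= 1 ->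
  entry (standard_tuple p) (pos p x e) = vertex x e.
Proof.
move=> hx he; rewrite entry_standard ?pos_len //.
rewrite /pos ltnNge leq_addr /= addKn addnn.
by case: e he => [|[|//]] _; rewrite ?addn0 ?addn1 ?doubleK ?odd_double ?uphalf_double //=
  ?uphalf_double ?odd_double.
Qed.

Lemma standard_diagram p : diagram p (standard_tuple p).
Proof.
split.
- by rewrite standard_pos //; apply: tree_shallow.
- move=> x x0 hx; rewrite !standard_pos //; rewrite /= /tree_rel; split.
    by split; [case: (x) x0 | right].
  move=> w [[w0 H1] [_ H2]]; case: H2 => // E; rewrite E /vertex /= in H1.
  by rewrite parent_parent /= in H1; case: H1 => H1; apply: w0; rewrite E H1.
- by move=> x e x' e' hx hx' he he'; rewrite !standard_pos.
- by move=> x e m hx he; rewrite !standard_pos.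
- move=> i hi; rewrite standard_pos ?geq_minr // entry_standard ?hi //.
  by rewrite /len; lia.
Qed.

Fixpoint encode (s : seq nat) : nat := if s is x :: s' then cpair x (encode s') else 0.

Lemma lookup_encode s i : i < size s -> lookup (encode s) i = nth 0 s i.
Proof.
rewrite /lookup; elim: s i => [|x s IH] [|i] //= Hi; first by rewrite cleft_pair.
by rewrite -IH // -iterS iterSr cright_pair.
Qed.

Lemma target_exists (s : seq nat) : exists p, arity p = size s /\
  forall i, i < size s -> target p i = nth 0 s i.
Proof.
have [N HN] := list_bound s.
exists (cpair (size s) (cpair N (encode s))); rewrite /arity /target /bound.
rewrite !(cleft_pair, cright_pair); split=> // i Hi; rewrite lookup_encode //.
apply/minn_idPl/ltnW/HN/In_mem; exact: mem_nth.
Qed.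

(** * Invariance under isomorphism *)

Lemma is_iso_id k (A : structure k) : is_iso (A := A) (B := A) id.
Proof.
split; [by exists id | by [] |].
by apply: val_inj; rewrite /= map_id.
Qed.

Lemma is_iso_comp k (A B C : structure k) (f : A -> B) (g : B -> C) :
  is_iso f -> is_iso g -> is_iso (g \o f).
Proof.
move=> [bf pf cf] [bg pg cg]; split; first exact: bij_comp.
  by move=> x y; rewrite pf pg.
by rewrite -cg -cf; apply: val_inj; rewrite /= map_comp.
Qed.

Lemma is_iso_inv k (A B : structure k) (f : A -> B) :
  is_iso f -> exists g : B -> A, [/\ is_iso g, cancel f g & cancel g f].
Proof.
move=> [[g fK gK] pf cf]; exists g; split=> //; split; first by exists f.
  by move=> x y; rewrite pf !gK.
by rewrite -cf; apply: val_inj; rewrite /= mapK.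
Qed.

Lemma iso_sym k (A B : structure k) : iso A B -> iso B A.
Proof. by case=> f /is_iso_inv [g [ig _ _]]; exists g. Qed.

Lemma iso_trans k (A B C : structure k) : iso A B -> iso B C -> iso A C.
Proof. by case=> f If [g Ig]; exists (g \o f); apply: is_iso_comp. Qed.

Lemma map_tupleK T U n (f : T -> U) (g : U -> T) (t : n.-tuple T) :
  cancel f g -> map_tuple g (map_tuple f t) = t.
Proof. by move=> fK; apply: val_inj; rewrite /= mapK. Qed.

Lemma qsat_iso k (A B : structure k) (f : A -> B) n (q : qf k n) t :
  is_iso f -> (qsat t q <-> qsat (map_tuple f t) q).
Proof.
case=> [[g fK gK] pf cf].
have tv u : Defs.tval (map_tuple f t) u = f (Defs.tval t u).
  by case: u => i /=; rewrite ?tnth_map // -cf tnth_map.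
elim: q => [|u v|u v|q IH|q1 IH1 q2 IH2|q1 IH1 q2 IH2] /=; rewrite ?tv; try tauto.
  exact: pf.
by split=> [->|/(can_inj fK)].
Qed.

Lemma sat_iso k (A B : structure k) (f : A -> B) n (phi : form k n) t :
  is_iso f -> (sat phi t <-> sat phi (map_tuple f t)).
Proof.
move=> If; have [g [_ fK gK]] := is_iso_inv If.
have mc m' m (a : m'.-tuple A) (b : m.-tuple A) :
    map_tuple f (cat_tuple a b) = cat_tuple (map_tuple f a) (map_tuple f b).
  by apply: val_inj; rewrite /= map_cat.
elim: phi t => {n} [n q|n phi IH|n J F IH|n J F IH|n m phi IH|n m phi IH] t /=.
- exact: qsat_iso.
- by rewrite IH.
- by split=> [] [i [Ji H]]; exists i; split=> //; apply/IH.
- by split=> H i Ji; apply/IH; apply: H.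
- split=> [] [s Hs]; first by exists (map_tuple f s); rewrite -mc; apply/IH.
  by exists (map_tuple g s); apply/IH; rewrite mc (map_tupleK _ gK).
- split=> H s; last by apply/IH; rewrite mc.
  by rewrite -(map_tupleK s gK) -mc; apply/IH.
Qed.

Lemma aut_orbit_iso k (A B : structure k) (f : A -> B) n (t s : n.-tuple A) :
  is_iso f -> (aut_orbit t s <-> aut_orbit (map_tuple f t) (map_tuple f s)).
Proof.
move=> If; have [g [Ig fK gK]] := is_iso_inv If.
split=> [] [h [Ih E]].
  exists (f \o h \o g); split.
    by apply: is_iso_comp => //; apply: is_iso_comp.
  rewrite E; apply: val_inj; rewrite /= -!map_comp; apply: eq_map => x /=.
  by rewrite fK.
exists (g \o h \o f); split.
  by apply: is_iso_comp => //; apply: is_iso_comp.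
rewrite -(map_tupleK s fK) E; apply: val_inj; rewrite /= -!map_comp.
exact: eq_map.
Qed.

Lemma defines_iso k (A B : structure k) (f : A -> B) n (phi : form k n) (t : n.-tuple A) :
  is_iso f -> defines phi (aut_orbit t) -> defines phi (aut_orbit (map_tuple f t)).
Proof.
move=> If H s; have [g [Ig fK gK]] := is_iso_inv If.
by rewrite -(map_tupleK s gK) -(sat_iso _ _ If) -(aut_orbit_iso _ _ If).
Qed.

Lemma scott_sentence_iso C A B : iso A B ->
  has_scott_sentence C A -> has_scott_sentence C B.
Proof.
move=> AB [phi [Cphi H]]; exists phi; split=> // X cX; rewrite (H X cX).
split=> [AX|BX]; last exact: iso_trans AB BX.
exact: iso_trans (iso_sym AB) AX.
Qed.

Lemma orbits_definable_iso k (A B : structure k) a : iso A B ->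
  orbits_definable A a -> orbits_definable B a.
Proof.
move=> [f If] H n t; have [g [Ig fK gK]] := is_iso_inv If.
have [phi [Cphi D]] := H n (map_tuple g t).
exists phi; split=> //; rewrite -(map_tupleK t gK); exact: defines_iso.
Qed.

Lemma above_iso k (A B : structure k) (f : A -> B) x m :
  is_iso f -> above (@prec k A) x m -> above (@prec k B) (f x) m.
Proof.
case=> [[g fK gK] pf cf] [w [nd sw H]]; exists (List.map f w); split.
- by apply: FinFun.Injective_map_NoDup => //; apply: can_inj fK.
- by rewrite -sw; apply: List.length_map.
- by move=> y /List.in_map_iff [z [<- /H /pf]].
Qed.

Lemma deg_infinite_iso k (A B : structure k) (f : A -> B) x :
  is_iso f -> deg_is (@prec k A) x None -> deg_is (@prec k B) (f x) None.
Proof. by move=> If H m; split=> // _; apply: above_iso If _; apply/H. Qed.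

Lemma rich_root_infinite T (R : T -> T -> Prop) r : rich R r -> deg_is R r None.
Proof.
move=> [sh re] m; split=> // _.
suff [w [nd sw H]] : exists w : seq T, [/\ List.NoDup w, size w = m &
    forall y, List.In y w -> lev1 R r y].
  by exists w; split=> // y /H [].
elim: m => [|m [w [nd sw H]]]; first by exists [::]; split=> //; constructor.
have [y [Hy Ny _]] := re None w.
exists (y :: w); split; [by constructor | by rewrite /= sw |].
by move=> z [<-|/H].
Qed.

(** * The trees of the theorem *)

Lemma has_card_list T (P : T -> Prop) n : has_card P (Some n) ->
  exists w : seq T, [/\ List.NoDup w, size w = n & forall y, List.In y w <-> P y].
Proof.
case=> f [fi fP]; exists (List.map f (enum 'I_n)); split.
- apply: FinFun.Injective_map_NoDup => //.
  have : uniq (enum 'I_n) by apply: enum_uniq.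
  elim: (enum 'I_n) => [|i s IH] /=; first by constructor.
  by case/andP=> /negP Ni /IH; constructor => // /In_mem.
- by have := List.length_map f (enum 'I_n); rewrite -[List.length (enum _)]/(size (enum 'I_n))
    size_enum_ord.
- move=> y; rewrite fP List.in_map_iff; split; first by case=> i []; exists i.
  by case=> i <-; exists i; split=> //; apply/In_mem; rewrite mem_enum.
Qed.

Lemma has_card_infinite T (P : T -> Prop) (L : seq T) : has_card P None ->
  exists y, P y /\ ~ List.In y L.
Proof.
case=> f [fi fP]; have [|i [_ Ni]] := @pigeonhole _ f L; first by move=> i j _ _ /fi.
by exists (f i); split=> //; apply/fP; exists i.
Qed.

Section TreeFacts.
Variable A : structure 0.

(** By induction on the number of predecessors of y: an element between x and y
    has fewer predecessors than y. *)
Lemma child_below (x y : A) : is_tree A -> prec x y ->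
  exists z, child x z /\ (z = y \/ prec z y).
Proof.
case=> irr tr lv _ _ xy; have [n] := lv y.
elim/ltn_ind: n y xy => n IH y xy ly.
have [[z [xz zy]]|N] := classic (exists z, prec x z /\ prec z y); last first.
  by exists y; split; [split | left].
have [m lz] := lv z.
have mn : m < n.
  have [w [nd sw Hw]] := has_card_list lz; have [w' [nd' sw' Hw']] := has_card_list ly.
  rewrite -sw -sw'; apply: (@NoDup_incl_size _ (z :: w)).
    by constructor => // /Hw /irr.
  by move=> u [<-|/Hw uz]; apply/Hw' => //; apply: tr zy.
have [u [cu uz]] := IH m mn z xz lz.
by exists u; split=> //; right; case: uz => [->|uz] //; apply: tr zy.
Qed.

(** Above the root a chain of three elements yields a chain of three successive
    children, along which the rank drops three times. *)
Lemma rank2_height r (x y z : A) : is_tree A -> has_rank r (bfin 2) ->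
  prec r x -> prec x y -> ~ prec y z.
Proof.
move=> tA [rk Hrk lt _] rx xy yz; have [irr tr _ _ _] := tA.
have [a [ca ax]] := child_below tA rx.
have ay : prec a y by case: ax => [->|ax] //; apply: tr xy.
have [b [cb bay]] := child_below tA ay.
have bz : prec b z by case: bay => [->|H] //; apply: tr yz.
have [c [cc _]] := child_below tA bz.
have la := lt a ca; have [rka Hrka lta _] := Hrk a ca.
have lb := lta b cb; have [rkb Hrkb ltb _] := Hrka b cb.
have lc := ltb c cc.
have : olt (rkb c) (bfin 0).
  exact: (ole_trans lc (ole_trans lb la)).
by [].
Qed.

Lemma level1_lev1 r (x : A) : shallow (@prec 0 A) r -> level x 1 -> lev1 (@prec 0 A) r x.
Proof.
move=> sh /has_card_list [w [nd sw Hw]].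
case: w nd sw Hw => [|y [|]] // _ _ Hw.
have yx : prec y x by apply/Hw; left.
have E : y = r.
  case: (sh_root sh y) => // ry; have : List.In r [:: y] by apply/Hw; apply: sh_trans sh _ _ _ ry yx.
  by case.
split; first by rewrite -E.
by move=> z /Hw [<-|].
Qed.

Lemma lev1_child r (x y : A) : shallow (@prec 0 A) r -> lev1 (@prec 0 A) r x ->
  (child x y <-> prec x y).
Proof.
move=> sh [rx _]; split; first by case.
by move=> xy; split=> // -[z [xz zy]]; apply: sh_hgt sh _ _ _ _ rx xz zy.
Qed.

Lemma degree_deg_is r (x : A) c : shallow (@prec 0 A) r -> lev1 (@prec 0 A) r x ->
  degree x c -> deg_is (@prec 0 A) x c.
Proof.
move=> sh lx; have ch y := @lev1_child r x y sh lx.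
case: c => [d|] H m; last first.
  case: H => f [fi fP]; split=> // _; exists (List.map f (List.seq 0 m)); split.
  - by apply: FinFun.Injective_map_NoDup => //; apply: List.seq_NoDup.
  - exact: size_map_seq.
  - by move=> y /List.in_map_iff [i [<- _]]; apply/ch/fP; exists i.
have [w [nd sw Hw]] := has_card_list H.
split=> [[v [ndv <- Hv]]|md].
  by rewrite -sw; apply: NoDup_incl_size => // y /Hv /ch /Hw.
by apply: above_le md _; exists w; split=> // y /Hw /ch.
Qed.

Lemma A2_rich : is_A2 A -> exists r, rich (@prec 0 A) r.
Proof.
case=> cA tA [r [rr rk]] inf; have [irr tr lv lin _] := tA.
have root x : x = r \/ prec r x by have [->|N] := classic (x = r); [left | right; apply: rr].
have sh : shallow (@prec 0 A) r.
  split=> //.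
  move=> x y z w xy yz zw.
  have ry : prec r y by case: (root x) => [<-|rx] //; apply: tr xy.
  exact: rank2_height tA rk ry yz zw.
exists r; split=> // c L.
have [y [[ly dy] Ny]] := has_card_infinite L (inf c).
have l1 := level1_lev1 sh ly.
by exists y; split=> //; apply: (degree_deg_is sh l1 dy).
Qed.

Lemma has_card_bij T U (P : T -> Prop) (P' : U -> Prop) (f : T -> U) c :
  bijective f -> (forall x, P x <-> P' (f x)) -> has_card P c -> has_card P' c.
Proof.
move=> [g fK gK] PP.
by case: c => [n|] [h [hi hP]]; (exists (f \o h); split;
  first by apply: inj_comp => //; apply: can_inj fK);
  move=> y; rewrite -(gK y) -PP hP; split=> -[i E]; exists i => /=; rewrite ?E //;
  apply: (can_inj fK).
Qed.

Lemma O_omega_iso (f : A -> A) (t : 1.-tuple A) :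
  is_iso f -> O_omega t -> O_omega (map_tuple f t).
Proof.
move=> [bf pf cf]; rewrite /O_omega.
have -> : thead (map_tuple f t) = f (thead t) by rewrite /thead tnth_map.
have ch x y : child x y <-> child (f x) (f y).
  have [g fK gK] := bf; rewrite /child.
  split=> -[H N].
    split; first exact: (proj1 (pf _ _) H).
    by case=> z [H1 H2]; apply: N; exists (g z); split; apply: (proj2 (pf _ _)); rewrite gK.
  split; first exact: (proj2 (pf _ _) H).
  by case=> z [H1 H2]; apply: N; exists (f z); split; apply: (proj1 (pf _ _)).
case=> H1 H2; split.
  exact: (has_card_bij bf (fun y => pf y (thead t)) H1).
exact: (has_card_bij bf (ch (thead t)) H2).
Qed.

End TreeFacts.

Lemma root_part_map S T (RS : S -> S -> Prop) (RT : T -> T -> Prop) rS rT :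
  rich RS rS -> rich RT rT -> part_map RS RT rS rT (same_deg RS RT) [:: (rS, rT)].
Proof.
move=> riS riT; have [shS _] := riS; have [shT _] := riT; split.
- by left.
- by move=> ? ? ? ? /= [] // [<- <-] [] // [<- <-].
- move=> ? ? ? ? /= [] // [<- <-] [] // [<- <-].
  by split=> H; [case: (sh_irr shS H) | case: (sh_irr shT H)].
- move=> ? ? /= [] // [<- <-]; apply: (@deg_is_same _ _ _ _ _ _ None); exact: rich_root_infinite.
- by move=> ? ? z /= [] // [<- _] /(root_min shS).
- by move=> ? ? z /= [] // [_ <-] /(root_min shT).
Qed.

Lemma A2_iso A : is_A2 A -> iso (tree_struct predT) A.
Proof.
move=> hA; have [cA _ _ _] := hA; have [r ri] := A2_rich hA.
have cN : countable nat by exists id.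
have [f [bf pf _]] := rich_iso cN cA tree_rich ri (root_part_map tree_rich ri).
by exists f; split=> //; rewrite [LHS]tuple0 [RHS]tuple0.
Qed.

Lemma tuple1_eq T (t : 1.-tuple T) : t = [tuple thead t].
Proof. by apply: eq_from_tnth => i; rewrite ord1 [RHS](tnth_nth (thead t)). Qed.

Lemma O_omega_orbit (A : structure 0) (r : A) (t s : 1.-tuple A) : countable A -> rich (@prec 0 A) r ->
  lev1 (@prec 0 A) r (thead t) -> deg_is (@prec 0 A) (thead t) None ->
  lev1 (@prec 0 A) r (thead s) -> deg_is (@prec 0 A) (thead s) None ->
  aut_orbit t s.
Proof.
move=> cA ri lt dt ls ds; have [sh _] := ri.
have pm : part_map (@prec 0 A) (@prec 0 A) r r (same_deg (@prec 0 A) (@prec 0 A))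
    [:: (thead t, thead s); (r, r)].
  apply: (pm_add_lev1 sh sh (root_part_map ri ri)) => //.
  - exact: deg_is_same dt ds.
  - by case=> y [] // [E _]; case: lt => /[1!E] /(sh_irr sh).
  - by case=> y [] // [_ E]; case: ls => /[1!E] /(sh_irr sh).
have [f [bf pf fl]] := rich_iso cA cA ri ri pm.
exists f; split; first by split=> //; rewrite [LHS]tuple0 [RHS]tuple0.
rewrite (tuple1_eq t) (tuple1_eq s); apply: val_inj => /=.
by congr [:: _]; symmetry; apply: fl; left.
Qed.

Lemma countable_nat : countable nat.
Proof. by exists id. Qed.

(** * Definability of the orbit *)

Lemma O_omegaP (A : structure 0) (r : A) : is_A2 A -> rich (@prec 0 A) r ->
  exists t : 1.-tuple A, forall s : 1.-tuple A,
    (O_omega s <-> aut_orbit t s) /\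
    (O_omega s <-> lev1 (@prec 0 A) r (thead s) /\ deg_is (@prec 0 A) (thead s) None).
Proof.
move=> hA ri; have [cA tA _ inf] := hA; have [sh _] := ri.
have O_lev s : O_omega s -> lev1 (@prec 0 A) r (thead s) /\ deg_is (@prec 0 A) (thead s) None.
  case=> ls ds; have l1 := level1_lev1 sh ls; split=> //; exact: degree_deg_is sh l1 ds.
have [x [Hx _]] := has_card_infinite [::] (inf None).
exists [tuple x] => s.
have Ot : O_omega [tuple x] by [].
have [lt dt] := O_lev _ Ot.
have lev_orb : lev1 (@prec 0 A) r (thead s) /\ deg_is (@prec 0 A) (thead s) None ->
    aut_orbit [tuple x] s.
  by case=> ls ds; apply: (O_omega_orbit cA ri lt dt ls ds).
have orb_O : aut_orbit [tuple x] s -> O_omega s.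
  by case=> f [If ->]; apply: O_omega_iso.
by split; split; auto.
Qed.

(** The level need not be stated separately: an element with something below and
    something above it has level one. *)
Lemma infinite_degree_Pi2 : exists i, repP 1 2 i (fun A s =>
  forall m, exists u : seq A, size u = m.+1 /\
    (prec (entry u 0) (entry s 0) /\ all_above (entry s 0) (fun a => entry u a.+1) m)).
Proof.
have [||||idx [_ H]] := @repP2_family (fun=> 1) (fun _ _ => 0) (fun _ z => z.+1)
  (fun _ z => c_and (c_lt 1 0) (c_above 0 2 z)).
- by solve_computable.
- by rewrite /computable2; solve_computable.
- by rewrite /computable2; solve_computable.
- rewrite /computable2 /c_and; solve_computable; last by apply: computable_c_above; solve_computable.
pose Q z : spred := fun A s => prec (entry s 1) (entry s 0) /\
  all_above (entry s 0) (fun a => entry s (2 + a)) z.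
exists (idx 0); apply: repP_iff (H 0 Q _) => [A s s1|z]; last first.
  by apply: repQ_and; [apply: repQ_lt | apply: repQ_above].
case: s s1 => [|x [|]] // _.
split=> [Hs m|Hs z w /size0nil ->].
  by have [u [su Hu]] := Hs m [::] erefl; exists u.
by have [u [su Hu]] := Hs z; exists u.
Qed.

Lemma infinite_degreeE (A : structure 0) r (x : A) : shallow (@prec 0 A) r ->
  (forall m, exists u : seq A, size u = m.+1 /\
    (prec (entry u 0) x /\ all_above x (fun a => entry u a.+1) m)) <->
  (lev1 (@prec 0 A) r x /\ deg_is (@prec 0 A) x None).
Proof.
move=> sh; split.
  move=> H; split.
    have [u [_ [px /(_ 0 0 isT isT) [xw _]]]] := H 1.
    case: (shallow_cases sh x) => [E|//|[p [[rp _] px']]].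
      by case: (root_min sh (x := entry u 0)); rewrite -E.
    by case: (sh_hgt sh rp px' xw).
  move=> m; split=> // _; apply/above_all_above.
  case: (H m) => [[|y u] [//= [su] [_ Hu]]]; exists u; split=> //.
case=> [[rx _] dx] m; have /above_all_above [u [su Hu]] := proj2 (dx m) I.
by exists (r :: u); rewrite /= su.
Qed.

Lemma orbits_definable_ge3 k (A : structure 0) (r : A) (p : k.-tuple A) b : rich (@prec 0 A) r ->
  orbits_definable (name_params p) b -> ole (bfin 3) b.
Proof.
move=> ri H; case: (bfin_total 3 b) => // b3.
have [x [_ dx K]] := @Sigma2_finite_degree k (name_params p) r ri.
have [phi [Cphi D]] := H 1 [tuple x].
have [|y [ny /D [f [If E]]]] := K b phi b3 Cphi.
  by apply/D; exists id; split; [apply: is_iso_id | apply: val_inj].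
have yf : y = f x by have := congr1 (fun t : 1.-tuple (name_params p) => thead t) E.
by apply: False_ind; apply: ny; rewrite yf; apply: deg_infinite_iso If _.
Qed.

(** * Lower bounds for Scott sentences *)

(** One companion serves the formulas true of u and the sentences at once. *)
Lemma Pi3_companion n (u : n.-tuple nat) :
  exists B : structure 0, [/\ countable B, ~ iso (tree_struct predT) B &
    exists v : n.-tuple B,
      (forall (psi : form 0 n) a, ole a (bfin 3) -> is_Pi a psi ->
         @sat 0 (tree_struct predT) n psi u -> sat psi v) /\
      (forall (psi : form 0 0) a, ole a (bfin 3) -> is_Pi a psi ->
         @sat 0 (tree_struct predT) 0 psi [tuple of [::]] -> @sat 0 B 0 psi [tuple of [::]])].
Proof.
have [Q [l [ni pm pu]]] := tree_companion u.
exists (tree_struct Q); split=> //; first exact: countable_nat.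
have transfer m (psi : form 0 m) c (w : m.-tuple nat) : ole c (bfin 3) -> is_Pi c psi ->
    paired l w w -> @sat 0 (tree_struct predT) m psi w -> @sat 0 (tree_struct Q) m psi w.
  move=> c3 Hpsi pw; apply: (@Pi3_transfer 0 (tree_struct predT) (tree_struct Q) 0 0 m c psi w w l
    tree_rich (tree_shallow Q) (tree_realizesA Q) c3 Hpsi pm pw).
  by case.
exists u; split=> psi c c3 Hpsi; first exact: (transfer _ psi c u c3 Hpsi pu).
by apply: (transfer 0 psi c _ c3 Hpsi); case.
Qed.

(** A true Sigma_4 sentence has witnesses u satisfying a Pi_3 formula; a
    companion over u keeps it, as well as any true Pi_3 sentence. *)
Lemma Sigma4_Pi3_companion (phi chi : form 0 0) a c :
  ole a (bfin 4) -> is_Sigma a phi -> ole c (bfin 3) -> is_Pi c chi ->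
  @sat 0 (tree_struct predT) 0 phi [tuple of [::]] ->
  @sat 0 (tree_struct predT) 0 chi [tuple of [::]] ->
  exists B : structure 0, [/\ countable B, ~ iso (tree_struct predT) B,
    @sat 0 B 0 phi [tuple of [::]] & @sat 0 B 0 chi [tuple of [::]]].
Proof.
move=> a4 Hphi c3 Hchi Sphi Schi.
case: phi Hphi Sphi => //.
  move=> q Hq Sq; have [B [cB nB [v [_ H]]]] := Pi3_companion [tuple of [::]].
  exists B; split=> //; last exact: H c3 Hchi Schi.
  by apply: (H (QF q) a) => //; apply: (ole_trans Hq).
move=> J F [_ HF] [i [Ji]]; have := HF i Ji.
case EF: (F i) => [| | | |m psi|] // [b [ba Hb]] [u Hu].
have [B [cB nB [v [H1 H2]]]] := Pi3_companion (cat_tuple [tuple of [::]] u).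
exists B; split=> //; last exact: H2 c3 Hchi Schi.
exists i; split=> //; rewrite EF; exists v.
have -> : cat_tuple [tuple of [::]] v = v by apply: val_inj.
exact: H1 (olt_bfin ba a4) Hb Hu.
Qed.

(** A Sigma_4 sentence is excluded as well, so the level of a Sigma complexity
    must exceed 4. *)
Lemma scott_complexity_ge_Pi4 (H : complexity) :
  has_scott_sentence (class_in H) (tree_struct predT) -> complexity_le (CPi (bfin 4)) H.
Proof.
case=> phi [Cphi Sphi].
have T0 : @sat 0 (tree_struct predT) 0 phi [tuple of [::]].
  by apply/Sphi; [exact: countable_nat | exists id; apply: is_iso_id].
have tr : is_Pi (k := 0) (n := 0) bzero (QF (QTrue 0 0)) by [].
case: H Cphi => a Cphi.
- case: (bfin_total 5 a) => [H|a4]; first by left.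
  have [B [cB nB SB _]] := Sigma4_Pi3_companion a4 Cphi (I : ole bzero (bfin 3)) tr T0 I.
  by case: nB; apply/Sphi.
- case: (bfin_total 5 a) => [H|a4]; first by left.
  case: (bfin_total 4 a) => [H|a3]; first by right.
  have [B [cB nB [v [_ K]]]] := Pi3_companion [tuple of [::]].
  by case: nB; apply/Sphi => //; apply: K a3 Cphi T0.
- case: (bfin_total 5 a) => [H|a4]; first by left.
  case: (bfin_total 4 a) => [H|a3]; first by right.
  case: Cphi => psi [chi [Cpsi Cchi E]]; subst phi.
  have T1 := T0 0 isT; have T2 := T0 1 isT.
  have [B [cB nB S1 S2]] := Sigma4_Pi3_companion a4 Cpsi a3 Cchi T1 T2.
  by case: nB; apply/Sphi => //; case=> [|[|]].
Qed.

(** * The Scott family and the Scott sentence *)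

Definition realized (p : nat) : spred := fun A s =>
  exists u : seq A, size u = (bound p + bound p).+2 /\ diagram p (s ++ u).

Lemma realized_Sigma3 : exists idx, computable idx /\ forall p, repS (arity p) 3 (idx p) (realized p).
Proof.
have [idx2 [c2 H2]] := diagram_Pi2.
have [||idx3 [c3 H3]] := @repS_single 2 arity (fun p => (bound p + bound p).+2) idx2 _ _ c2.
- by rewrite /arity; solve_computable.
- by rewrite /bound; solve_computable.
by exists idx3; split=> // p; apply: H3; apply: H2.
Qed.

Lemma standard_realized p :
  exists t : (arity p).-tuple (tree_struct predT),
    (forall i, i < arity p -> entry t i = target p i) /\ realized p t.
Proof.
have ss : size (take (arity p) (standard_tuple p)) == arity p.
  by rewrite size_takel // size_standard /len leq_addr.
exists (Tuple ss); split.
  move=> i Hi.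
  have -> : entry (Tuple ss) i = entry (standard_tuple p) i by rewrite /entry /= nth_take.
  by rewrite entry_standard ?Hi // /len; lia.
exists (drop (arity p) (standard_tuple p)); split.
  by rewrite size_drop size_standard /len addKn.
by rewrite /= cat_take_drop; apply: standard_diagram.
Qed.

(** A realization provides an automorphism by [diagram_iso].  Conversely the
    tuple named by p realizes its own diagram, and formulas are invariant under
    automorphisms. *)
Lemma realized_orbit p (t : (arity p).-tuple (tree_struct predT)) :
  (forall i, i < arity p -> entry t i = target p i) ->
  forall s : (arity p).-tuple (tree_struct predT), realized p s <-> aut_orbit t s.
Proof.
move=> Ht s.
have real_orb (s' : (arity p).-tuple (tree_struct predT)) : realized p s' ->
    exists f : tree_struct predT -> tree_struct predT, is_iso f /\ s' = map_tuple f t.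
  case=> u [su dg].
  have ri : exists r, rich (@prec 0 (tree_struct predT)) r by exists 0; apply: tree_rich.
  have [f [If Hf]] := diagram_iso (countable_nat : countable (tree_struct predT)) ri dg.
  exists f; split=> //; apply: eq_from_tnth => i.
  have hi : i < arity p := ltn_ord i.
  have := dg_tuple dg hi; rewrite -Hf ?geq_minr // entry_catl ?size_tuple //.
  rewrite tnth_map !(tnth_nth (dflt (tree_struct predT))) /entry => ->.
  by rewrite -Ht.
split; first exact: real_orb.
case=> f [If ->].
have [t' [Ht' real]] := standard_realized p.
have -> : t = t'.
  apply: eq_from_tnth => i.
  have hi : i < arity p := ltn_ord i.
  by rewrite !(tnth_nth (dflt (tree_struct predT))) -!/(entry _ _) Ht // Ht'.
have [idx [_ H]] := realized_Sigma3; have [phi [_ Hphi]] := H p.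
by apply/Hphi; apply: (proj1 (sat_iso _ _ If)); apply/Hphi.
Qed.

(** Every parameter p is meaningful, so the family is the range of a computable
    function; any tuple is named by some p whose bound exceeds its entries. *)
Lemma canonical_scott_family : has_ce_cSigma_scott_family canonical_A2 (bfin 3).
Proof.
have [idx [ci H]] := realized_Sigma3.
have [f If] := iso_sym canonical_iso.
have [|E [_ HE]] := @ce_ranges (fun _ z => idx z).
  by apply: (computable_comp ci); solve_computable.
have rep p (phi : form 0 (arity p)) : Sigma_index (fin_notation 3) (idx p) phi ->
    cSigma_with_index (bfin 3) (idx p) phi.
  move=> Hi; exists (fin_notation 3), (bfin 3); split.
  - exact: fin_notationP.
  - by split; exact: (ole_refl (bfin 3)).
  - exact: Hi.
have def p (phi : form 0 (arity p)) (t : (arity p).-tuple (tree_struct predT)) :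
    cSigma_with_index (bfin 3) (idx p) phi ->
    (forall i, i < arity p -> entry t i = target p i) ->
    defines phi (aut_orbit (A := canonical_A2) (map_tuple f t)).
  move=> [a [be [_ _ Hi]]] Ht; apply: defines_iso => // s.
  rewrite -(realized_orbit Ht s); have [phi' [Hi' Hphi']] := H p.
  by rewrite -Hphi'; apply: (proj1 (index_sat 0 _) _ _ _ Hi _ _ Hi').
exists (fun i => exists p, i = idx p); split.
- by exists (E 0) => x; rewrite HE.
- move=> _ [p ->]; have [phi [Hi _]] := H p.
  by exists (arity p), phi; apply: rep.
- split.
    move=> n phi [_ [[p ->] Hphi]].
    have En : n = arity p.
      have [phi' [Hi' _]] := H p; case: Hphi => a [be [_ _ Hi]].
      move: Hi'; move E': (idx p) Hi => i Hi Hi'.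
      case: Hi Hi' => {i E'} [q|a0 e b psi _ _ _] Hi'.
        move E': (cpair _ _) Hi' => j Hj; move E3: (fin_notation 3) Hj => l Hj.
        by case: Hj E' => [q'|? ? ? ? ? ? ?] /cpair_inj [] // _ /cpair_inj [].
      move E': (cpair _ _) Hi' => j Hj.
      by case: Hj E' => [q'|? ? ? ? ? ? ?] /cpair_inj [] // _ /cpair_inj [_ /cpair_inj []].
    subst n; have [t [Ht _]] := standard_realized p.
    by exists (map_tuple f t); apply: def.
  move=> n s; have [g [Ig fK gK]] := is_iso_inv If.
  have [p [Ep Hp]] := target_exists (map_tuple g s).
  rewrite size_tuple in Ep Hp; subst n.
  have [phi [Hi _]] := H p; exists phi; split; first by exists (idx p); split; [exists p | apply: rep].
  rewrite -(map_tupleK s gK); apply: def; first exact: rep.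
  move=> i hi; rewrite Hp //; apply: set_nth_default; by rewrite size_tuple.
Qed.

(** The conjuncts are the diagrams with no free variable, for all bounds M. *)
Lemma computable_scott_sentence : has_scott_sentence (class_c (CPi (bfin 4))) (tree_struct predT).
Proof.
have [idx [ci H]] := realized_Sigma3.
pose param z := cpair 0 (cpair z 0).
have ar z : arity (param z) = 0 by rewrite /arity cleft_pair.
have [|||idx4 [_ H4]] := @repP_family 3 (fun=> 0) (fun _ _ => 0) (fun _ z => idx (param z)).
- by solve_computable.
- by rewrite /computable2; solve_computable.
- by apply: (computable_comp ci); rewrite /param; solve_computable.
have [|phi [Hi Hphi]] := H4 0 (fun z => realized (param z)).
  by move=> z; have := H (param z); rewrite ar.
exists phi; split.
  exists (idx4 0), (fin_notation 4), (bfin 4); split.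
  - exact: fin_notationP.
  - by split; exact: (ole_refl (bfin 4)).
  - exact: Hi.
move=> B cB; split.
  move=> /Hphi HB.
  have dgs N : exists p s, bound p = N /\ @diagram p B s.
    have [u [_ dg]] := HB N [::] erefl; exists (param N), u; split=> //.
    by rewrite /bound cright_pair cleft_pair.
  have [p [s [_ dg]]] := dgs 0.
  by have [f [If _]] := diagram_iso cB (diagrams_rich dgs) dg; exists f.
case=> f If.
have -> : [tuple of [::]] = map_tuple f [tuple of [::]] by apply: val_inj.
apply: (proj1 (sat_iso _ _ If)); apply/Hphi => z u /size0nil ->.
have [t [_ real]] := standard_realized (param z).
by case: t real => t /= st; move: (st); rewrite ar => /eqP/size0nil ->.
Qed.

Theorem theorem1p3 (A : structure 0) (hA : is_A2 A) :
  ((exists t : 1.-tuple A, forall s : 1.-tuple A, O_omega s <-> aut_orbit t s) /\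
   definable (class_in (CPi (bfin 2))) (@O_omega A) /\
   ~ definable (class_in (CSigma (bfin 2))) (@O_omega A))
  /\
  (has_scott_sentence (class_in (CPi (bfin 4))) A /\
   ~ has_scott_sentence (class_in (CPi (bfin 3))) A /\
   ~ has_scott_sentence (class_in (CSigma (bfin 3))) A /\
   ~ has_scott_sentence (class_in (CdSigma (bfin 3))) A /\
   is_SSC A (CPi (bfin 4)) /\
   is_SR A (bfin 3) /\
   is_pSR A (bfin 3))
  /\
  ((computable_rel (@prec 0 canonical_A2) /\ iso A canonical_A2) /\
   has_ce_cSigma_scott_family canonical_A2 (bfin 3) /\
   has_scott_sentence (class_c (CPi (bfin 4))) A /\
   is_computable_SSC A (CPi (bfin 4))).
Proof.
have TA := A2_iso hA.
have [r ri] := A2_rich hA; have [sh _] := ri.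
have [t0 Ht0] := O_omegaP hA ri.
have lower H : has_scott_sentence (class_in H) A -> complexity_le (CPi (bfin 4)) H.
  by move=> K; apply: scott_complexity_ge_Pi4; apply: scott_sentence_iso K; apply: iso_sym.
have c_in H : has_scott_sentence (class_c H) A -> has_scott_sentence (class_in H) A.
  by case=> phi [C S]; exists phi; split=> //; apply: class_c_in.
have cPi4 : has_scott_sentence (class_c (CPi (bfin 4))) A.
  exact: scott_sentence_iso TA computable_scott_sentence.
have orb3 : orbits_definable A (bfin 3).
  apply: orbits_definable_iso (iso_trans canonical_iso TA) _.
  move=> n t; have [S [_ _ [_ HS]]] := canonical_scott_family.
  have [phi [[i [_ Hi]] D]] := HS n t; exists phi; split=> //.
  exact: cSigma_is_Sigma Hi.
have noparams : name_params (A := A) [tuple of [::]] = A.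
  by case: (A) => T R c i; rewrite /name_params /= (tuple0 c).
have SR3 : is_SR A (bfin 3).
  split=> // b Hb; apply: (orbits_definable_ge3 (p := [tuple of [::]]) ri).
  by rewrite noparams.
do ! split=> //.
- by exists t0 => s; case: (Ht0 s).
- have [i [phi [Hi Hphi]]] := infinite_degree_Pi2.
  exists phi; split; first exact: (proj2 (index_is_class 0 1)) Hi _ (fin_notationP 2).
  move=> s; rewrite Hphi (infinite_degreeE _ sh) (proj2 (Ht0 s)).
  by rewrite /entry /thead (tnth_nth (dflt A)).
- case=> phi [Cphi D].
  have [x [lx dx K]] := Sigma2_finite_degree ri.
  have [|y [ny /D]] := K _ phi (ole_refl _) Cphi.
    by apply/D; apply/(proj2 (Ht0 _)).
  by move/(proj2 (Ht0 _)) => [_]; apply: ny.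
- exact: c_in.
- by move/lower => /= [[]|[[]]].
- by move/lower => /= [[]|[]].
- by move/lower => /= [[]|[[]]].
- exact: c_in.
- by exists 0, [tuple of [::]]; rewrite noparams.
- by move=> k p b [Hb _]; apply: orbits_definable_ge3 ri Hb.
- exact: canonical_computable.
- exact: iso_sym (iso_trans canonical_iso TA).
- exact: canonical_scott_family.
- by move=> H /c_in; apply: lower.
Qed.
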